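(* Let $n\ge1$. In the case $\mathbf{a}=(a_{1/2},0,a_{5/2})$, $$\prod_{i=1}^n\left(a_{1/2}(x_i^{1/2}+x_i^{-1/2})+a_{5/2}(x_i^{5/2}+x_i^{-5/2})\right)=\sum_{p=0}^n\sum_{q=0}^{n-p}a_{5/2}^p\,\psi_{q,r}(\mathbf{a})\,\mathrm{ch}^{O(2n)}_{((5/2)^p,(3/2)^q,(1/2)^r)}(\mathbf{x},\overline{\mathbf{x}}),$$ where $n=p+q+r$ and $$\psi_{q,r}(\mathbf{a})=\chi_{q,r}-a_{5/2}^3\,\chi_{q,r-3}+\sum_{s=2}^r\eta_s\,a_{1/2}\,a_{5/2}^{s-1}\,\chi_{q,r-s}+\zeta_r\,a_{5/2}^{r+1}\,\chi_{q-1,0}+\omega_r\,a_{5/2}^{r+2}\,\chi_{q-2,0},$$ with $$\eta_s=\begin{cases}1&s\equiv1,2\bmod5\\-1&s\equiv0,3\bmod5\\0&\text{otherwise}\end{cases},\quad \zeta_r=\begin{cases}1&r\equiv3\bmod5\\-1&r\equiv4\bmod5\\0&\text{otherwise}\end{cases},\quad \omega_r=\begin{cases}1&r\equiv1\bmod5\\-1&r\equiv0\bmod5\\0&\text{otherwise}\end{cases},$$ and $$\chi_{q,r}=\chi_{q,r}(\mathbf{a})=Q_qR_r+\sum_{s=1}^r\left(\sigma_s\,a_{1/2}\,a_{5/2}^s\,Q_{q-1}R_{r-s}+\tau_s\,a_{1/2}\,a_{5/2}^{s+1}\,Q_{q-2}R_{r-s}\right)-a_{5/2}^4\,Q_{q-3}R_{r-1},$$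 where $$\sigma_s=\begin{cases}1&s\equiv3\bmod5\\-1&s\equiv1\bmod5\\0&\text{otherwise}\end{cases},\qquad \tau_s=\begin{cases}1&s\equiv3\bmod5\\-1&s\equiv0\bmod5\\0&\text{otherwise}\end{cases}.$$ Here $Q_q=0$ for $q<0$ and $R_r=0$ for $r<0$, while $$Q_0=1,\qquad Q_q=-a_{1/2}a_{5/2}\,Q_{q-2}+a_{1/2}a_{5/2}^2\,Q_{q-3}+a_{5/2}^5\,Q_{q-5}\quad\text{if } q>0,$$ $$R_0=1,\qquad R_r=a_{1/2}R_{r-1}-a_{1/2}a_{5/2}^3R_{r-4}+a_{5/2}^5R_{r-5}+\sum_{s=3}^r\rho_s\,a_{1/2}^2\,a_{5/2}^{s-2}\,R_{r-s}\quad\text{if } r>0,$$ where $$\rho_s=\begin{cases}1&s\equiv2,3\bmod5\\-2&s\equiv0\bmod5\\0&\text{otherwise}\end{cases}.$$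
   Context: $\mathbf{x}=(x_1,\dots,x_n)$ are indeterminates (with formal square roots $x_i^{1/2}$), $\overline{\mathbf{x}}=(x_1^{-1},\dots,x_n^{-1})$; $a_{1/2},a_{5/2}$ are arbitrary scalar parameters; empty sums are $0$. $((5/2)^p,(3/2)^q,(1/2)^r)$ is the weight with $p$ components $5/2$, then $q$ components $3/2$, then $r$ components $1/2$. For a weight $\lambda$ with weakly decreasing positive half-odd-integer components, $\mathrm{ch}^{O(2n)}_\lambda(\mathbf{x},\overline{\mathbf{x}})$ is the spin character of $O(2n)$ of highest weight $\lambda$, restricted to elements with eigenvalues $(\mathbf{x},\overline{\mathbf{x}})$; it equals $\mathrm{ch}^{SO(2n)}_{\lambda_+}+\mathrm{ch}^{SO(2n)}_{\lambda_-}$ with $\lambda_\pm=(\lambda_1,\dots,\lambda_{n-1},\pm\lambda_n)$. Here $\mathrm{ch}^{SO(2n)}_\mu$ is given by Weyl's formula $\sum_w\mathrm{sgn}(w)\mathbf{x}^{w(\mu+\rho)}/\sum_w\mathrm{sgn}(w)\mathbf{x}^{w(\rho)}$ with $w$ running over all permutations and even numbers of sign changes of the $n$ coordinates, $\mathrm{sgn}(w)$ the determinant of $w$, and $\rho=(n-1,n-2,\dots,0)$ (this Weyl vector is unrelated to the numbers $\rho_s$ in the claim). *)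

(* Defs.v *)
From HB Require Import structures.
From mathcomp Require Import all_boot all_order all_algebra all_fingroup.
From mathcomp Require Import mpoly.

Set Implicit Arguments.
Unset Strict Implicit.
Unset Printing Implicit Defensive.

Import Order.TTheory GRing.Theory Num.Theory.
Local Open Scope ring_scope.

(* Upper bound of a sum "s = m, .., r" with r : int, as the excluded end of a
   nat range; the range is empty when r < 0. *)
Definition sum_end (r : int) : nat := if r is Posz m then m.+1 else 0%N.

(* The function f on int with f k = 0 for k < 0, f 0 = 1, and f k = F f k for
   k > 0, when F f k only involves values of f below k (see rec_seqE);
   rec_tab F m is correct up to index m. *)
Section RecSeq.
Variable K : comNzRingType.
Implicit Type F : (int -> K) -> int -> K.

Fixpoint rec_tab F (m : nat) : int -> K :=
  if m is m'.+1 then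
    fun k => if k == m'.+1%:Z then F (rec_tab F m') k else rec_tab F m' k
  else fun k => (k == 0)%:R.

Definition rec_seq F (k : int) : K :=
  if k is Posz m then rec_tab F m k else 0.

Lemma rec_seq_lt0 F k : k < 0 -> rec_seq F k = 0.
Proof. by case: k. Qed.

Lemma rec_seq0 F : rec_seq F 0 = 1.
Proof. by []. Qed.

Lemma rec_tab_lt0 F m k : k < 0 -> rec_tab F m k = 0.
Proof.
case: k => // k _; elim: m => [|m IHm] //=.
Qed.

Lemma rec_tabE F m k : k <= m%:Z -> rec_tab F m k = rec_seq F k.
Proof.
case: k => [k|k _]; last by rewrite rec_tab_lt0.
rewrite lez_nat; elim: m => [|m IHm]; first by rewrite leqn0 => /eqP ->.
rewrite leq_eqVlt => /orP[/eqP -> //|lt_k_m] /=.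
by rewrite eqz_nat ltn_eqF // IHm.
Qed.

Lemma rec_seqE F k :
  (forall f g : int -> K, (forall j, j < k -> f j = g j) -> F f k = F g k) ->
  0 < k -> rec_seq F k = F (rec_seq F) k.
Proof.
case: k => // -[|m] // extF _; rewrite /= eqxx; apply: extF => j lt_j.
by apply: rec_tabE; rewrite -ltzD1 addrC -intS.
Qed.

End RecSeq.

Section Coefficients.

(* a1 and a5 stand for a_{1/2} and a_{5/2} *)
Variables (K : comNzRingType) (a1 a5 : K).

Definition rho (s : nat) : int :=
  match (s %% 5)%N with 2 | 3 => 1 | 0 => - 2%:Z | _ => 0 end.

Definition sigma (s : nat) : int :=
  match (s %% 5)%N with 3 => 1 | 1 => -1 | _ => 0 end.

Definition tau (s : nat) : int :=
  match (s %% 5)%N with 3 => 1 | 0 => -1 | _ => 0 end.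

Definition eta (s : nat) : int :=
  match (s %% 5)%N with 1 | 2 => 1 | 0 | 3 => -1 | _ => 0 end.

Definition zeta (r : nat) : int :=
  match (r %% 5)%N with 3 => 1 | 4 => -1 | _ => 0 end.

Definition omega (r : nat) : int :=
  match (r %% 5)%N with 1 => 1 | 0 => -1 | _ => 0 end.

Definition Qstep (Q : int -> K) (q : int) : K :=
  - (a1 * a5 * Q (q - 2)) + a1 * a5 ^+ 2 * Q (q - 3) + a5 ^+ 5 * Q (q - 5).

Definition Qcoef : int -> K := rec_seq Qstep.

Definition Rstep (R : int -> K) (r : int) : K :=
  a1 * R (r - 1) - a1 * a5 ^+ 3 * R (r - 4) + a5 ^+ 5 * R (r - 5)
  + \sum_(3 <= s < sum_end r)
      (rho s)%:~R * a1 ^+ 2 * a5 ^+ (s - 2)%N * R (r - s%:Z).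

Definition Rcoef : int -> K := rec_seq Rstep.

Lemma Qcoef_rec q : 0 < q -> Qcoef q = Qstep Qcoef q.
Proof.
apply: rec_seqE => f g fg.
by rewrite /Qstep !fg // gtrBl.
Qed.

Lemma Rcoef_rec r : 0 < r -> Rcoef r = Rstep Rcoef r.
Proof.
apply: rec_seqE => f g fg.
rewrite /Rstep !fg ?gtrBl //; congr (_ + _).
rewrite big_nat_cond [RHS]big_nat_cond; apply: eq_bigr => s.
case/andP=> /andP[s_ge3 _] _.
by rewrite fg // gtrBl ltz_nat (leq_trans _ s_ge3).
Qed.

Definition chi (q r : int) : K :=
  Qcoef q * Rcoef r
  + \sum_(1 <= s < sum_end r)
      ((sigma s)%:~R * a1 * a5 ^+ s * Qcoef (q - 1) * Rcoef (r - s%:Z)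
       + (tau s)%:~R * a1 * a5 ^+ s.+1 * Qcoef (q - 2) * Rcoef (r - s%:Z))
  - a5 ^+ 4 * Qcoef (q - 3) * Rcoef (r - 1).

Definition psi (q r : nat) : K :=
  chi q r - a5 ^+ 3 * chi q (r%:Z - 3)
  + \sum_(2 <= s < r.+1)
      (eta s)%:~R * a1 * a5 ^+ s.-1 * chi q (r%:Z - s%:Z)
  + (zeta r)%:~R * a5 ^+ r.+1 * chi (q%:Z - 1) 0
  + (omega r)%:~R * a5 ^+ r.+2 * chi (q%:Z - 2) 0.

End Coefficients.

(* Weights are stored doubled, as integer column vectors: mu : 'cV[int]_n
   stands for the weight mu / 2.  Correspondingly the i-th variable of the
   polynomial ring is the square root x_i^{1/2}. *)

Section Characters.
Variables (A : idomainType) (n : nat).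

Definition ratfun := {fraction {mpoly A[n]}}.

Definition cst (c : A) : ratfun := tofrac c%:MP_[n].

Definition sqrtx (i : 'I_n) : ratfun := tofrac ('X_i : {mpoly A[n]}).

Definition xpow (mu : 'cV[int]_n) : ratfun :=
  \prod_(i < n) sqrtx i ^ mu i ord0.

(* the signed permutation with permutation s and sign changes at S *)
Definition signed_perm (s : 'S_n) (S : {set 'I_n}) : 'M[int]_n :=
  diag_mx (\row_i (-1) ^+ (i \in S)) *m perm_mx s.

(* \sum_w sgn(w) x^{w(mu)} over the Weyl group of type D_n *)
Definition weyl_alt (mu : 'cV[int]_n) : ratfun :=
  \sum_(s : 'S_n) \sum_(S : {set 'I_n} | ~~ odd #|S|)
    (\det (signed_perm s S))%:~R * xpow (signed_perm s S *m mu).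

(* twice (n-1, n-2, .., 0) *)
Definition weyl_rho : 'cV[int]_n := \col_(i < n) (2 * (n - i.+1))%N%:Z.

Definition chSO (mu : 'cV[int]_n) : ratfun :=
  weyl_alt (mu + weyl_rho) / weyl_alt weyl_rho.

Definition flip_last (lam : 'cV[int]_n) : 'cV[int]_n :=
  \col_(i < n) (if i.+1 == n then - lam i ord0 else lam i ord0).

(* For lam with all components odd, positive and weakly decreasing: the
   spin character ch^{O(2n)} of highest weight lam / 2. *)
Definition chO (lam : 'cV[int]_n) : ratfun := chSO lam + chSO (flip_last lam).

(* twice ((5/2)^p, (3/2)^q, (1/2)^(n-p-q)) *)
Definition weight531 (p q : nat) : 'cV[int]_n :=
  \col_(i < n) (if (i < p)%N then 5 else if (i < p + q)%N then 3 else 1).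

End Characters.

(* Main.v *)
Require Import Defs.
From mathcomp Require Import all_boot all_order all_algebra all_fingroup.
From mathcomp Require Import mpoly.
From mathcomp Require Import ring zify.

Set Implicit Arguments.
Unset Strict Implicit.
Unset Printing Implicit Defensive.

Import Order.TTheory GRing.Theory Num.Theory.
Local Open Scope ring_scope.

(** Put t_i = x_i + 1/x_i, and let V_e be the monic Chebyshev polynomials of the
    third kind, normalised by
      x^(e + 1/2) + x^-(e + 1/2) = (x^(1/2) + x^(-1/2)) V_e(x + 1/x).
    Weyl's formula makes each spin character a quotient of determinants
    ([weyl_alt_flip], [weyl_alt_rho]), and after extracting the factors
    x_i^(1/2) + x_i^(-1/2) it becomes a minor det (V_(e_c)(t_i)) over the
    Vandermonde determinant of the t_i ([chO_weight531]).  For the weight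
    ((5/2)^p, (3/2)^q, (1/2)^r) the n exponents e_c are 0, .., n+1 with exactly
    r and r+q+1 left out.

    When a5 is nonzero, dividing by it reduces to a5 = 1 and a = a1/a5
    ([psi_homog]).  The i-th factor of the product is then
    x_i^(1/2) + x_i^(-1/2) times g(t_i), where g = V_2 + a is a monic quadratic
    polynomial.  So the product times the Vandermonde determinant is
    essentially the n + 2 by n + 2 determinant whose rows are n evaluations at
    the t_i and the two coefficient functionals of the remainder modulo g, in
    the basis 1, X, g, g X, g X^2, ..  This determinant only depends on the
    degrees of a monic basis ([det_monic]); computing it in the basis of the V_e
    and expanding along the two remainder rows ([det_two_rows]) gives
    ([prod_quad_minors]) a sum over the pairs of omitted exponents (r, r+q+1),
    with coefficient (-1)^q W(r, r+q+1), where W(i, j) is the 2 by 2 determinant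
    of the remainders of V_i and V_j modulo g.

    It remains to see that psi_(q,r) = (-1)^q W(r, r+q+1) ([psi_chebV]).  Extended
    to negative indices by V_(-1-j) = V_j, the remainders satisfy a linear
    recurrence of order 5 over all integers.  For fixed r this is, up to signs,
    the recurrence of Q, so that (-1)^q W(r, r+q+1) is a combination of Q_q, ..,
    Q_(q-3) with coefficients W(r, r+1), - W(r, r+2), W(r-2, r), - W(r-1, r)
    ([row_seqE]); this is the shape of the formula for psi ([psi_norm]).  The
    same recurrence and antisymmetry relate the diagonals W(r, r+1) and
    W(r, r+2) to each other ([diag1_eq], [diag2_eq]).  Multiplying by
    1 - z^5, with z the shift, removes all the sums with 5-periodic signs;
    eliminating the second diagonal then yields the recurrence of R
    ([psi_op_R], [psi_op_sigmaR]).

    When a5 = 0, only the weight (1/2)^n contributes, and the identity says that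
    its minor is the Vandermonde determinant. *)

(** * Causal sequences as a module over the polynomials in a shift *)

Section Shift.
Variable F : comNzRingType.
Implicit Types (p q : {poly F}) (f g : int -> F) (r : int).

(** Horner scheme for the action of a polynomial in the shift z, where (z f)(r)
    = f(r - 1). *)
Fixpoint shift_seq (s : seq F) f r : F :=
  if s is c :: s' then c * f r + shift_seq s' f (r - 1) else 0.

Definition zact p f r := shift_seq (polyseq p) f r.

(** Causal sequences play the role of formal power series. *)
Definition causal f := forall r, r < 0 -> f r = 0.

Definition delta r : F := (r == 0)%:R.

Lemma zact0 f r : zact 0 f r = 0.
Proof. by rewrite /zact polyseq0. Qed.

(** This Horner step characterises the action and drives the inductions below. *)
Lemma zact_MXaddC p c f r : zact (p * 'X + c%:P) f r = zact p f (r - 1) + c * f r.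
Proof.
rewrite -cons_poly_def /zact polyseq_cons.
case: nilP => [sp0|_] /=; last by rewrite addrC.
rewrite sp0 /= add0r polyseqC.
by case: eqP => [->|_] /=; rewrite ?mul0r ?addr0.
Qed.

Lemma zact_ext p f g r : (forall k, k <= r -> f k = g k) -> zact p f r = zact p g r.
Proof.
elim/poly_ind: p r => [|p c IHp] r fg; first by rewrite !zact0.
rewrite !zact_MXaddC fg //; congr (_ + _); apply: IHp => k le_k.
by apply: fg; apply: le_trans le_k _; rewrite gerBl.
Qed.

Lemma zact_eq p f g r : f =1 g -> zact p f r = zact p g r.
Proof. by move=> fg; apply: zact_ext => k _. Qed.

Lemma zactD p q f r : zact (p + q) f r = zact p f r + zact q f r.
Proof.
elim/poly_ind: p q r => [|p c IHp] q r; first by rewrite zact0 !add0r.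
elim/poly_ind: q => [|q d _]; first by rewrite zact0 !addr0.
have -> : p * 'X + c%:P + (q * 'X + d%:P) = (p + q) * 'X + (c + d)%:P.
  by rewrite polyCD; ring.
by rewrite !zact_MXaddC IHp; ring.
Qed.

Lemma zactC c f r : zact c%:P f r = c * f r.
Proof.
by have := zact_MXaddC 0 c f r; rewrite mul0r add0r zact0 add0r.
Qed.

Lemma zact_CM c p f r : zact (c%:P * p) f r = c * zact p f r.
Proof.
elim/poly_ind: p r => [|p d IHp] r; first by rewrite mulr0 zact0 mulr0.
rewrite mulrDr mulrA -polyCM !zact_MXaddC IHp; ring.
Qed.

Lemma zactN p f r : zact (- p) f r = - zact p f r.
Proof. by rewrite -mulN1r -polyC1 -polyCN zact_CM mulN1r. Qed.

Lemma zactXM p f r : zact ('X * p) f r = zact p f (r - 1).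
Proof.
by rewrite mulrC -[p * 'X]addr0 -polyC0 zact_MXaddC mul0r addr0.
Qed.

Lemma zact1 f r : zact 1 f r = f r.
Proof. by rewrite -polyC1 zactC mul1r. Qed.

Lemma zactX f r : zact 'X f r = f (r - 1).
Proof. by rewrite -['X]mulr1 zactXM zact1. Qed.

Lemma zactXn n f r : zact 'X^n f r = f (r - n%:Z).
Proof.
elim: n r => [|n IHn] r; first by rewrite expr0 zact1 subr0.
by rewrite exprS zactXM IHn -addn1 PoszD opprD addrA addrAC.
Qed.

Lemma zactM p q f r : zact (p * q) f r = zact p (zact q f) r.
Proof.
elim/poly_ind: p r => [|p c IHp] r; first by rewrite mul0r !zact0.
rewrite mulrDl -mulrA mulrCA zactD zactXM IHp zact_CM.
by rewrite zact_MXaddC.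
Qed.

Lemma zactCA p q f r : zact p (zact q f) r = zact q (zact p f) r.
Proof. by rewrite -!zactM mulrC. Qed.

Lemma zact_addf p f g r : zact p (fun k => f k + g k) r = zact p f r + zact p g r.
Proof.
elim/poly_ind: p r => [|p c IHp] r; first by rewrite !zact0 addr0.
by rewrite !zact_MXaddC IHp; ring.
Qed.

Lemma zact_scalef p c f r : zact p (fun k => c * f k) r = c * zact p f r.
Proof.
elim/poly_ind: p r => [|p d IHp] r; first by rewrite !zact0 mulr0.
by rewrite !zact_MXaddC IHp; ring.
Qed.

Lemma causal_zact p f : causal f -> causal (zact p f).
Proof.
move=> cf r r0; rewrite (@zact_ext _ _ (fun=> 0)).
  elim/poly_ind: p r {r0} => [|p c IHp] r; first by rewrite zact0.
  by rewrite zact_MXaddC IHp mulr0 addr0.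
by move=> k le_k; apply/cf/(le_lt_trans le_k).
Qed.

(** A polynomial with constant coefficient 1 is invertible as a power series, so
    identities between causal sequences may be checked after multiplication by
    it. *)
Lemma zact_inj p f g : p`_0 = 1 -> causal f -> causal g ->
  zact p f =1 zact p g -> f =1 g.
Proof.
elim/poly_ind: p => [|p c _].
  by rewrite coef0 => /eqP; rewrite eq_sym oner_eq0.
rewrite coefD coefMX coefC /= add0r => -> cf cg fg.
suff fgn n r : r < n%:Z -> f r = g r.
  by move=> r; apply: (fgn `|r|.+1); lia.
elim: n r => [|n IHn] r r_lt; first by rewrite cf ?cg.
have := fg r; rewrite !zact_MXaddC !mul1r.
rewrite (@zact_ext p f g (r - 1)); first exact: addrI.
by move=> k le_k; apply: IHn; lia.
Qed.

Definition zactE := (zactD, zactN, zact_CM, zactXn, zactX, zact1, zact0, zactC).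

End Shift.

(** * Convolution with eventually periodic coefficients *)

Section Conv.
Variable F : comNzRingType.
Implicit Types (f g : int -> F) (r : int) (k : nat -> int).

Definition conv k m f r : F :=
  \sum_(m <= s < sum_end r) (k s)%:~R * f (r - s%:Z).

Lemma conv_causal k m f : causal (conv k m f).
Proof. by move=> [//|n] _; rewrite /conv big_geq. Qed.

(** By causality the upper bound of the sum is immaterial as soon as it is large
    enough; a bound that does not depend on r is what allows shifts to be
    compared. *)
Lemma conv_widen k m f r N : causal f -> r < (m + N)%N%:Z ->
  conv k m f r = \sum_(s < N) (k (m + s)%N)%:~R * f (r - (m + s)%N%:Z).
Proof.
move=> cf rN.
have -> : conv k m f r = \sum_(m <= s < m + N) (k s)%:~R * f (r - s%:Z).
  rewrite /conv.
  have zero s : (sum_end r <= s)%N -> (k s)%:~R * f (r - s%:Z) = 0.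
    by move=> le_s; rewrite cf ?mulr0 //; case: r le_s {rN} => //= n; lia.
  have le_end : (sum_end r <= m + N)%N by case: r rN {zero} => //= n; lia.
  rewrite [RHS](bigID (fun s => s < sum_end r)%N) /= [X in _ = _ + X]big1 ?addr0.
    rewrite (big_nat_widen _ _ (m + N)) //; exact: eq_bigl.
  by move=> s; rewrite -leqNgt; apply: zero.
rewrite -{1}[m]add0n big_addn addKn big_mkord.
by apply: eq_bigr => s _; rewrite addnC.
Qed.

(** The generating series of a 5-periodic k has denominator 1 - z^5, so this
    factor turns the convolution into a finite combination of shifts, read off
    from one period of k. *)
Lemma conv_period k m c0 c1 c2 c3 c4 f r :
  (forall s, k (s + 5)%N = k s) ->
  [:: k m; k m.+1; k m.+2; k m.+3; k m.+4] = [:: c0; c1; c2; c3; c4] ->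
  causal f ->
  zact (1 - 'X^5) (conv k m f) r
  = zact (c0%:~R%:P * 'X^m + c1%:~R%:P * 'X^(m.+1) + c2%:~R%:P * 'X^(m.+2)
         + c3%:~R%:P * 'X^(m.+3) + c4%:~R%:P * 'X^(m.+4)) f r.
Proof.
move=> k5 [<- <- <- <- <-] cf; rewrite !zactE.
rewrite (@conv_widen k m f r (`|r|.+1 + 5)) //; last lia.
rewrite (@conv_widen k m f (r - 5%:Z) (`|r|.+1)) //; last lia.
rewrite addnC big_split_ord /=.
rewrite [X in _ + X - _](_ : _ = \sum_(s < `|r|.+1)
   (k (m + s)%N)%:~R * f (r - 5%:Z - (m + s)%N%:Z)).
  by rewrite addrK !big_ord_recr big_ord0 /= add0r addn0 !addnS !addn0.
apply: eq_bigr => s _; congr (_ %:~R * f _); last lia.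
by rewrite -[RHS]k5; congr k; lia.
Qed.

End Conv.

(** * The sequences Q and R after normalising a5 = 1 *)

Lemma rho5 s : rho (s + 5) = rho s. Proof. by rewrite /rho modnDr. Qed.
Lemma sigma5 s : sigma (s + 5) = sigma s. Proof. by rewrite /sigma modnDr. Qed.
Lemma eta5 s : eta (s + 5) = eta s. Proof. by rewrite /eta modnDr. Qed.
Lemma zeta5 s : zeta (s + 5) = zeta s. Proof. by rewrite /zeta modnDr. Qed.

Section Normalised.
Variables (F : comNzRingType) (a : F).
Implicit Types (f g : int -> F) (r q : int).

Local Notation Q := (Qcoef a 1).
Local Notation R := (Rcoef a 1).
Local Notation dlt := (@delta F).

Lemma causal_delta : causal dlt.
Proof. by case. Qed.

Lemma causal_Q : causal Q.
Proof. exact: rec_seq_lt0. Qed.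

Lemma causal_R : causal R.
Proof. exact: rec_seq_lt0. Qed.

(** The generating series of Q is the inverse of this polynomial. *)
Definition Q_pol : {poly F} := 1 + a%:P * 'X^2 - a%:P * 'X^3 - 'X^5.

Lemma zact_Q : zact Q_pol Q =1 dlt.
Proof.
move=> q; rewrite /Q_pol !zactE.
have [q0|q0|->] := ltrgtP q 0.
- by rewrite ?causal_Q ?causal_delta //; [ring|lia..].
- rewrite Qcoef_rec // /Qstep !expr1n /delta gt_eqF //=; ring.
by rewrite (_ : dlt 0 = 1) // (_ : Q 0 = 1) // !causal_Q //; ring.
Qed.

(** The part of the recurrence of R that does not come from the sum with
    coefficients rho. *)
Definition diag_pol : {poly F} := 1 - a%:P * 'X + a%:P * 'X^4 - 'X^5.

Lemma zact_R_diag r : zact diag_pol R r = dlt r + a ^+ 2 * conv rho 3 R r.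
Proof.
rewrite /diag_pol !zactE.
have [r0|r0|->] := ltrgtP r 0.
- by rewrite (conv_causal _ _ _ r0) ?causal_R ?causal_delta //; [ring|lia..].
- rewrite Rcoef_rec // /Rstep !expr1n /delta gt_eqF //= /conv big_distrr /=.
  rewrite (eq_bigr (fun s => a ^+ 2 * ((rho s)%:~R * R (r - s%:Z)))); last first.
    by move=> s _; rewrite expr1n; ring.
  ring.
by rewrite /conv big_geq // (_ : dlt 0 = 1) // (_ : R 0 = 1) // !causal_R //; ring.
Qed.

Definition period_pol : {poly F} := 1 - 'X^5.

(** (1 - z^5) times the recurrence of R; the last factor is (1 - z^5) times the
    sum of rho(s) z^s over s >= 3. *)
Definition R_pol : {poly F} :=
  period_pol * diag_pol - (a ^+ 2)%:P * ('X^3 - 2%:R * 'X^5 + 'X^7).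

Lemma zact_R r : zact R_pol R r = zact period_pol dlt r.
Proof.
rewrite /R_pol zactD zactM (zact_eq _ _ zact_R_diag) zact_addf zact_scalef.
rewrite (@conv_period _ rho 3 1 0 (- 2%:Z) 0 1 _ _ rho5 erefl causal_R) zactN zact_CM.
rewrite -addrA -mulrBr -zactN -zactD.
rewrite [X in _ * zact X _ _](_ : _ = 0) ?zact0 ?mulr0 ?addr0 //.
ring.
Qed.

(** The linear operator, in the variable r, that produces psi from chi, up to
    the terms with zeta and omega. *)
Definition psi_op f r := f r - f (r - 3) + a * conv eta 2 f r.

(** The symbol of [psi_op], multiplied by 1 - z^5. *)
Definition psi_pol : {poly F} :=
  period_pol * (1 - 'X^3) + a%:P * ('X^2 - 'X^3 - 'X^5 + 'X^6).

Lemma psi_op_causal f : causal f -> causal (psi_op f).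
Proof.
move=> cf r r0; rewrite /psi_op (conv_causal _ _ _ r0) // !cf //; [ring|lia].
Qed.

Lemma zact_psi_op f r : causal f -> zact period_pol (psi_op f) r = zact psi_pol f r.
Proof.
move=> cf; rewrite /psi_pol /psi_op zact_addf zact_scalef.
rewrite (@conv_period _ eta 2 1 (-1) 0 (-1) 1 _ _ eta5 erefl cf).
rewrite [RHS]zactD zactM zact_CM; congr (_ + _ * _).
  by apply: zact_eq => s; rewrite !zactE.
congr (zact _ _ _); ring.
Qed.

(** The coefficient of Q_(q-1) in chi_(q,r). *)
Definition sigmaR r := a * conv sigma 1 R r.

Lemma sigmaR_causal : causal sigmaR.
Proof. by move=> r r0; rewrite /sigmaR (conv_causal _ _ _ r0) mulr0. Qed.

Lemma zact_S r : zact period_pol sigmaR r = zact (a%:P * ('X^3 - 'X)) R r.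
Proof.
rewrite /sigmaR zact_scalef.
rewrite (@conv_period _ sigma 1 (-1) 0 1 0 0 _ _ sigma5 erefl causal_R).
rewrite zact_CM; congr (_ * zact _ _ _).
ring.
Qed.

(** The values zeta(r), extended by 0 to r < 0; writing them as a convolution
    makes [conv_period] available. *)
Definition zeta_seq r := conv zeta 0 dlt r.

Lemma zeta_seq_causal : causal zeta_seq.
Proof. exact: conv_causal. Qed.

Lemma zeta_seq_nat (m : nat) : zeta_seq m = (zeta m)%:~R.
Proof.
rewrite /zeta_seq /conv /= big_nat_recr //= big_nat big1 ?add0r.
  by rewrite subrr /delta eqxx mulr1.
by move=> s /andP[_ lt_s]; rewrite /delta subr_eq0 eqz_nat gtn_eqF ?mulr0.
Qed.

Lemma zact_Z r : zact period_pol zeta_seq r = zact ('X^3 - 'X^4) dlt r.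
Proof.
rewrite /zeta_seq (@conv_period _ zeta 0 0 0 0 1 (-1) _ _ zeta5 erefl causal_delta).
congr (zact _ _ _); ring.
Qed.

End Normalised.

(** * The coefficients psi as a wedge of two reflected recurrences *)

Lemma int_case5 (r : int) :
  r < 0 \/ [\/ r = 0, r = 1, r = 2 | r = 3] \/ r = 4 \/ 5 <= r.
Proof.
have [r0|r0] := ltP r 0; [by left | right].
case: r r0 => [[|[|[|[|[|n]]]]]|//] _.
- by left; constructor 1.
- by left; constructor 2.
- by left; constructor 3.
- by left; constructor 4.
- by right; left.
by right; right; lia.
Qed.

(** [W] abstracts the wedge u_i v_j - u_j v_i of two sequences over the integers
    that are invariant under j -> -1 - j and satisfy the recurrence with
    characteristic polynomial X^5 + a X^3 + a X^2 + 1. *)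
Section Wedge.
Variables (F : comNzRingType) (a : F) (W : int -> int -> F).
Implicit Types i j r q : int.

Hypothesis Wii : forall i, W i i = 0.
Hypothesis WC : forall i j, W j i = - W i j.
Hypothesis Wrec : forall i j,
  W i j = - a * W i (j - 2) - a * W i (j - 3) - W i (j - 5).
Hypothesis Wrefl : forall i j, W i (- 1 - j) = W i j.
Hypothesis W01 : W 0 1 = 1.
Hypothesis W02 : W 0 2 = 0.
Hypothesis W12 : W 1 2 = a.

Local Notation Q := (Qcoef a 1).
Local Notation R := (Rcoef a 1).
Local Notation dlt := (@delta F).

(** Apply the recurrence in the second index until it drops below the first,
    exchange the indices, and apply it once more; the second diagonal only meets
    the first one. *)
Lemma W_diag2 r : W r (r + 2)
  = a * W (r - 1) (r - 1 + 1) - a * W (r - 3) (r - 3 + 1)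
    + W (r - 5) (r - 5 + 2).
Proof.
have e1 := Wrec r (r + 2); have e2 := Wrec (r - 3) r.
rewrite (_ : r + 2 - 2 = r) in e1; last lia.
rewrite (_ : r + 2 - 3 = r - 1) in e1; last lia.
rewrite (_ : r + 2 - 5 = r - 3) in e1; last lia.
rewrite e1 Wii (WC (r - 1) r) (WC (r - 3) r) e2.
rewrite (_ : r - 2 = r - 3 + 1); last lia.
rewrite (_ : r - 1 + 1 = r); last lia.
rewrite (_ : r - 5 + 2 = r - 3); last lia.
by rewrite (WC (r - 5)) Wii; ring.
Qed.

(** The same reduction for the first diagonal. *)
Lemma W_diag1 r : W r (r + 1)
  = a * W (r - 1) (r - 1 + 1) + a * W (r - 2) (r - 2 + 2)
    - a * W (r - 4) (r - 4 + 2) - a * W (r - 4) (r - 4 + 1)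
    + W (r - 5) (r - 5 + 1).
Proof.
have e1 := Wrec r (r + 1); have e2 := Wrec (r - 4) r.
rewrite (_ : r + 1 - 2 = r - 1) in e1; last lia.
rewrite (_ : r + 1 - 3 = r - 2) in e1; last lia.
rewrite (_ : r + 1 - 5 = r - 4) in e1; last lia.
rewrite e1 (WC (r - 1) r) (WC (r - 2) r) (WC (r - 4) r) e2.
rewrite (_ : r - 4 + 2 = r - 2); last lia.
rewrite (_ : r - 4 + 1 = r - 3); last lia.
rewrite (_ : r - 1 + 1 = r); last lia.
rewrite (_ : r - 2 + 2 = r); last lia.
rewrite (_ : r - 5 + 1 = r - 4); last lia.
by rewrite (WC (r - 5)); ring.
Qed.

(** The two diagonals, cut off at r < 0 so as to be causal; the sign of the
    second one is that of (-1)^q for q = 1. *)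
Definition diag1 r : F := if 0 <= r then W r (r + 1) else 0.

Definition diag2 r : F := if 0 <= r then - W r (r + 2) else 0.

Lemma causal_diag1 : causal diag1.
Proof. by move=> r; rewrite /diag1 ltNge => /negbTE ->. Qed.

Lemma causal_diag2 : causal diag2.
Proof. by move=> r; rewrite /diag2 ltNge => /negbTE ->. Qed.

Lemma Wrefll i j : W (- 1 - i) j = W i j.
Proof. by rewrite WC Wrefl -WC. Qed.

(** The values next to the diagonal follow from W(0,1), W(0,2), W(1,2) by
    reflecting the negative indices produced by the recurrence. *)
Lemma W23 : W 2 3 = a ^+ 2 + a.
Proof.
rewrite Wrec (_ : 3 - 2 = 1) // (_ : 3 - 3 = 0) // (_ : 3 - 5 = - 1 - 1) // Wrefl.
by rewrite (WC 1) (WC 0) W12 W02; ring.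
Qed.

Lemma W13 : W 1 3 = a.
Proof.
rewrite Wrec (_ : 3 - 2 = 1) // (_ : 3 - 3 = 0) // (_ : 3 - 5 = - 1 - 1) // Wrefl.
by rewrite Wii (WC 0) W01; ring.
Qed.

Lemma W24 : W 2 4 = a ^+ 2.
Proof.
rewrite Wrec (_ : 4 - 2 = 2) // (_ : 4 - 3 = 1) // (_ : 4 - 5 = - 1 - 0) // Wrefl.
by rewrite Wii (WC 0) (WC 1) W12 W02; ring.
Qed.

(** [W_diag1] for the causal diagonals.  Cutting off the values at r < 0 creates
    the source term, computed from the values of W near the origin. *)
Lemma diag1_eq : zact (diag_pol a) diag1 =1 fun r =>
  zact (- a%:P * ('X^2 - 'X^4)) diag2 r
  + zact (1 + a%:P * 'X^2 - (1 + a)%:P * 'X^3) dlt r.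
Proof.
move=> r; rewrite /diag_pol mulNr !zactE /diag1 /diag2 /delta.
case: (int_case5 r) => [r0|[[->|->|->|->]|[->|r5]]].
- do ?[rewrite ifN; last lia]; do ?[rewrite (_ : (_ == _) = false); last lia].
  by ring.
- by rewrite /= W01; ring.
- by rewrite /= W12 W01; ring.
- by rewrite /= W12 W23 W02; ring.
- have e : W 3 4 = a * W 2 3 + a * W 1 3 - a * W (- 1 - 0) 1
    - a * W (- 1 - 0) 0 + W (- 1 - 1) (- 1 - 0) := W_diag1 3.
  change (W 3 4 - a * W 2 3 + a * 0 - 0
    = - (a * (- W 1 3 - 0)) + (0 + a * 0 - (1 + a) * 1)).
  by rewrite e !Wrefll Wrefl (WC 0 1) Wii W01; ring.
- have e : W 4 5 = a * W 3 4 + a * W 2 4 - a * W 0 2 - a * W 0 1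
    + W (- 1 - 0) 0 := W_diag1 4.
  change (W 4 5 - a * W 3 4 + a * W 0 1 - 0
    = - (a * (- W 2 4 - - W 0 2)) + (0 + a * 0 - (1 + a) * 0)).
  by rewrite e !Wrefll Wii; ring.
do ?[rewrite ifT; last lia]; do ?[rewrite (_ : (_ == _) = false); last lia].
by rewrite W_diag1; ring.
Qed.

(** [W_diag2] for the causal diagonals; the source is the numerator of the
    generating series of zeta. *)
Lemma diag2_eq r : zact (period_pol F) diag2 r =
  zact (- a%:P * ('X - 'X^3)) diag1 r + zact ('X^3 - 'X^4) dlt r.
Proof.
rewrite /period_pol mulNr !zactE /diag1 /diag2 /delta.
case: (int_case5 r) => [r0|[[->|->|->|->]|[->|r5]]].
- do ?[rewrite ifN; last lia]; do ?[rewrite (_ : (_ == _) = false); last lia].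
  by ring.
- by rewrite /= W02; ring.
- by rewrite /= W13 W01; ring.
- by rewrite /= W24 W12; ring.
- have e : W 3 5 = a * W 2 3 - a * W 0 1 + W (- 1 - 1) 0 := W_diag2 3.
  change (- W 3 5 - 0 = - (a * (W 2 3 - W 0 1)) + (1 - 0)).
  by rewrite e Wrefll (WC 0) W01; ring.
- have e : W 4 6 = a * W 3 4 - a * W 1 2 + W (- 1 - 0) 1 := W_diag2 4.
  change (- W 4 6 - 0 = - (a * (W 3 4 - W 1 2)) + (0 - 1)).
  by rewrite e Wrefll W01; ring.
do ?[rewrite ifT; last lia]; do ?[rewrite (_ : (_ == _) = false); last lia].
by rewrite W_diag2; ring.
Qed.

Lemma period_pol0 : (period_pol F)`_0 = 1.
Proof. by rewrite /period_pol coefB coef1 coefXn /= subr0. Qed.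

Lemma coef0_prod1 (p p' : {poly F}) : p`_0 = 1 -> p'`_0 = 1 -> (p * p')`_0 = 1.
Proof. by move=> p0 p'0; rewrite coef0M p0 p'0 mulr1. Qed.

Lemma R_pol0 : (R_pol a)`_0 = 1.
Proof.
by rewrite /R_pol /diag_pol /period_pol -!horner_coef0 !hornerE !expr0n /=; ring.
Qed.

(** Eliminating the second diagonal between [diag1_eq] and [diag2_eq] leaves the
    polynomial of the recurrence of R.  The source terms combine to the symbol
    of [psi_op]. *)
Lemma zact_R_diag1 r : zact (R_pol a) diag1 r = zact (psi_pol a) dlt r.
Proof.
rewrite /R_pol zactD zactM (zact_eq _ _ diag1_eq) zact_addf zactCA.
rewrite (zact_eq _ _ diag2_eq) zact_addf -!zactM zactN.
rewrite (_ : - a%:P * _ * (- a%:P * _) = (a ^+ 2)%:P * ('X^3 - 2%:R * 'X^5 + 'X^7)).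
  have -> : psi_pol a = - a%:P * ('X^2 - 'X^4) * ('X^3 - 'X^4)
    + period_pol F * (1 + a%:P * 'X^2 - (1 + a)%:P * 'X^3).
    by rewrite /psi_pol /period_pol; ring.
  by rewrite zactD; ring.
by ring.
Qed.

(** Both sides solve the recurrence of R with the same source, up to a factor
    that [zact_inj] cancels. *)
Lemma psi_op_R : psi_op a R =1 diag1.
Proof.
apply: (@zact_inj _ (R_pol a * period_pol F));
  first exact: coef0_prod1 R_pol0 period_pol0.
- exact/psi_op_causal/causal_R.
- exact: causal_diag1.
move=> r; rewrite zactM (zact_eq _ _ (fun r => zact_psi_op _ _ (@causal_R _ a))).
rewrite zactCA (zact_eq _ _ (@zact_R _ a)) zactCA.
by rewrite -(zact_eq _ _ zact_R_diag1) -zactM [period_pol F * _]mulrC.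
Qed.

Lemma psi_op_sigmaR r : psi_op a (sigmaR a) r + zeta_seq F r = diag2 r.
Proof.
move: r; apply: (@zact_inj _ (period_pol F * period_pol F));
  first exact: coef0_prod1 period_pol0 period_pol0.
- move=> r r0; rewrite (psi_op_causal _ (@sigmaR_causal _ a)) ?zeta_seq_causal ?addr0 //.
- exact: causal_diag2.
move=> r; rewrite zact_addf !zactM.
rewrite (zact_eq _ _ (fun r => zact_psi_op _ _ (@sigmaR_causal _ a))).
rewrite zactCA (zact_eq _ _ (@zact_S _ a)) zactCA.
rewrite -(zact_eq _ _ (fun r => zact_psi_op _ _ (@causal_R _ a))).
rewrite (zact_eq _ _ (fun r => zact_eq _ r psi_op_R)).
rewrite (zact_eq _ _ (@zact_Z _)) (zact_eq _ _ diag2_eq) zact_addf zactCA.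
congr (_ + _); rewrite -!zactM; congr (zact _ _ _); ring.
Qed.

(** The row W(r, r + q + 1), with the sign that turns the recurrence of W into
    that of Q. *)
Definition row_seq r q : F :=
  if 0 <= q then (-1) ^+ `|q| * W r (r + q + 1) else 0.

(** The source of the row for the recurrence of Q, determined by the first values
    of the row; the last two coefficients are simplified by the recurrence of W,
    which continues the row to the left of the diagonal. *)
Definition row_pol r : {poly F} :=
  (W r (r + 1))%:P - (W r (r + 2))%:P * 'X + (W (r - 2) r)%:P * 'X^2
  - (W (r - 1) r)%:P * 'X^3.

Lemma causal_row_seq r : causal (row_seq r).
Proof. by move=> q; rewrite /row_seq ltNge => /negbTE ->. Qed.

Lemma row_seq_eq r q : zact (Q_pol a) (row_seq r) q = zact (row_pol r) dlt q.
Proof.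
rewrite /Q_pol /row_pol !zactE /row_seq /delta.
case: (int_case5 q) => [r0|[[->|->|->|->]|[->|q5]]].
- do ?[rewrite ifN; last lia]; do ?[rewrite (_ : (_ == _) = false); last lia].
  rewrite /=; ring.
- change ((-1) ^+ 0 * W r (r + 0 + 1) + a * 0 - a * 0 - 0
    = W r (r + 1) * 1 - W r (r + 2) * 0 + W (r - 2) r * 0 - W (r - 1) r * 0).
  by rewrite addr0; ring.
- change ((-1) ^+ 1 * W r (r + 1 + 1) + a * 0 - a * 0 - 0
    = W r (r + 1) * 0 - W r (r + 2) * 1 + W (r - 2) r * 0 - W (r - 1) r * 0).
  by rewrite -(addrA r); ring.
- have := Wrec r (r + 3).
  rewrite (_ : r + 3 - 2 = r + 1); last lia.
  rewrite (_ : r + 3 - 3 = r); last lia.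
  rewrite (_ : r + 3 - 5 = r - 2); last lia.
  rewrite Wii (WC (r - 2)) => e.
  change ((-1) ^+ 2 * W r (r + 2 + 1) + a * ((-1) ^+ 0 * W r (r + 0 + 1)) - a * 0 - 0
    = W r (r + 1) * 0 - W r (r + 2) * 0 + W (r - 2) r * 1 - W (r - 1) r * 0).
  by rewrite -!(addrA r) add0r e; ring.
- have := Wrec r (r + 4).
  rewrite (_ : r + 4 - 2 = r + 2); last lia.
  rewrite (_ : r + 4 - 3 = r + 1); last lia.
  rewrite (_ : r + 4 - 5 = r - 1); last lia.
  rewrite (WC (r - 1)) => e.
  change ((-1) ^+ 3 * W r (r + 3 + 1) + a * ((-1) ^+ 1 * W r (r + 1 + 1))
    - a * ((-1) ^+ 0 * W r (r + 0 + 1)) - 0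
    = W r (r + 1) * 0 - W r (r + 2) * 0 + W (r - 2) r * 0 - W (r - 1) r * 1).
  by rewrite -!(addrA r) add0r e; ring.
- have := Wrec r (r + 5).
  rewrite (_ : r + 5 - 2 = r + 3); last lia.
  rewrite (_ : r + 5 - 3 = r + 2); last lia.
  rewrite (_ : r + 5 - 5 = r); last lia.
  rewrite Wii => e.
  change ((-1) ^+ 4 * W r (r + 4 + 1) + a * ((-1) ^+ 2 * W r (r + 2 + 1))
    - a * ((-1) ^+ 1 * W r (r + 1 + 1)) - 0
    = W r (r + 1) * 0 - W r (r + 2) * 0 + W (r - 2) r * 0 - W (r - 1) r * 0).
  by rewrite -!(addrA r) e; ring.
do ?[rewrite ifT; last lia]; do ?[rewrite (_ : (_ == _) = false); last lia].
have := Wrec r (r + q + 1).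
rewrite (_ : r + q + 1 - 2 = r + (q - 2) + 1); last lia.
rewrite (_ : r + q + 1 - 3 = r + (q - 3) + 1); last lia.
rewrite (_ : r + q + 1 - 5 = r + (q - 5) + 1); last lia.
have [m {q5 q}->] : exists m : nat, q = (m + 5)%N%:Z by exists `|q - 5|%N; lia.
rewrite (_ : `|(m + 5)%N%:Z| = (m + 5)%N)%N //.
rewrite (_ : `|(m + 5)%N%:Z - 2%:Z| = (m + 3))%N; last lia.
rewrite (_ : `|(m + 5)%N%:Z - 3%:Z| = (m + 2))%N; last lia.
rewrite (_ : `|(m + 5)%N%:Z - 5%:Z| = m)%N; last lia.
by rewrite !exprD => -> /=; ring.
Qed.

Lemma row_seqE r q : row_seq r q = zact (row_pol r) Q q.
Proof.
move: q; apply: (@zact_inj _ (Q_pol a)).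
- by rewrite /Q_pol -!horner_coef0 !hornerE !expr0n /=; ring.
- exact: causal_row_seq.
- exact/causal_zact/causal_Q.
by move=> q; rewrite row_seq_eq zactCA (zact_eq _ _ (@zact_Q _ a)).
Qed.

End Wedge.

Lemma tau_sigma s : tau (s + 2) = - sigma s.
Proof.
rewrite /tau /sigma -modnDml.
by have := ltn_pmod s (isT : 0 < 5)%N; case: (s %% 5)%N => [|[|[|[|[|]]]]].
Qed.

Lemma omega_zeta s : omega (s + 2) = - zeta s.
Proof.
rewrite /omega /zeta -modnDml.
by have := ltn_pmod s (isT : 0 < 5)%N; case: (s %% 5)%N => [|[|[|[|[|]]]]].
Qed.

Section ConvExtra.
Variable F : comNzRingType.
Implicit Types (f g : int -> F) (r : int) (k : nat -> int).

Lemma convD k m f g r :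
  conv k m (fun s => f s + g s) r = conv k m f r + conv k m g r.
Proof. by rewrite /conv -big_split; apply: eq_bigr => s _; rewrite /= mulrDr. Qed.

Lemma convZ k m c f r : conv k m (fun s => c * f s) r = c * conv k m f r.
Proof. by rewrite /conv big_distrr; apply: eq_bigr => s _; rewrite /= mulrCA. Qed.

Lemma conv_shift k m (c : nat) f r : causal f ->
  conv k m (fun s => f (s - c%:Z)) r = conv k m f (r - c%:Z).
Proof.
move=> cf; have cfc : causal (fun s => f (s - c%:Z)).
  by move=> s s0; apply: cf; lia.
rewrite (@conv_widen _ k m _ r `|r|.+1) //; last lia.
rewrite (@conv_widen _ k m f _ `|r|.+1) //; last lia.
by apply: eq_bigr => s _; rewrite addrAC.
Qed.

Variable a : F.

Lemma psi_opD f g r : psi_op a (fun s => f s + g s) r = psi_op a f r + psi_op a g r.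
Proof. by rewrite /psi_op convD; ring. Qed.

Lemma psi_opZ c f r : psi_op a (fun s => c * f s) r = c * psi_op a f r.
Proof. by rewrite /psi_op convZ; ring. Qed.

Lemma psi_op_shift (c : nat) f r : causal f ->
  psi_op a (fun s => f (s - c%:Z)) r = psi_op a f (r - c%:Z).
Proof. by move=> cf; rewrite /psi_op conv_shift // (addrAC r). Qed.

Lemma conv_tau r f : causal f -> conv tau 1 f r = - conv sigma 1 f (r - 2).
Proof.
move=> cf.
rewrite (@conv_widen _ tau 1 f r `|r|.+3) //; last lia.
rewrite (@conv_widen _ sigma 1 f (r - 2) `|r|.+1) //; last lia.
rewrite [LHS]big_ord_recl [X in _ + X = _]big_ord_recl /= !mul0r !add0r -sumrN.
apply: eq_bigr => s _.
rewrite -mulNr -rmorphN -tau_sigma /= /bump /=.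
by congr ((tau _)%:~R * f _); lia.
Qed.

Local Notation Q := (Qcoef a 1).
Local Notation R := (Rcoef a 1).
Local Notation S := (sigmaR a).

Lemma chi_norm q r : chi a 1 q r =
  Q q * R r + (Q (q - 1) * S r + (- Q (q - 2) * S (r - 2) + - Q (q - 3) * R (r - 1))).
Proof.
have -> : S (r - 2) = - (a * conv tau 1 R r).
  by rewrite conv_tau; [rewrite /sigmaR; ring | exact: causal_R].
rewrite /chi /sigmaR !expr1n.
rewrite (_ : \sum_(1 <= s < _) _
  = Q (q - 1) * (a * conv sigma 1 R r) + Q (q - 2) * (a * conv tau 1 R r)).
  by ring.
rewrite /conv !big_distrr -big_split /=; apply: eq_bigr => s _.
by rewrite !expr1n; ring.
Qed.

Lemma chi_norm0 q : chi a 1 q 0 = Q q.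
Proof.
have R0 : R 0 = 1 by [].
rewrite chi_norm (@sigmaR_causal _ a (0 - 2)) // (@causal_R _ a (0 - 1)) // R0.
by rewrite /sigmaR /conv big_geq //; ring.
Qed.

(** Collecting the coefficients of Q_q, .., Q_(q-3): since tau is sigma delayed
    by two steps up to sign, the coefficient of Q_(q-2) is a delayed copy of
    that of Q_(q-1). *)
Lemma psi_norm (q r : nat) : psi a 1 q r =
  Q q * psi_op a R r + Q (q%:Z - 1) * (psi_op a S r + (zeta r)%:~R)
  + Q (q%:Z - 2) * ((omega r)%:~R - psi_op a S (r%:Z - 2))
  - Q (q%:Z - 3) * psi_op a R (r%:Z - 1).
Proof.
rewrite -(psi_op_shift 2 _ (@sigmaR_causal _ a)) -(psi_op_shift 1 _ (@causal_R _ a)).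
transitivity (psi_op a (chi a 1 q) r + (zeta r)%:~R * Q (q%:Z - 1)
    + (omega r)%:~R * Q (q%:Z - 2)).
  rewrite /psi !chi_norm0 !expr1n /psi_op /conv big_distrr /=.
  rewrite (eq_bigr (fun s => a * ((eta s)%:~R * chi a 1 q (r%:Z - s%:Z)))).
    by ring.
  by move=> s _; rewrite expr1n; ring.
have -> : psi_op a (chi a 1 q) r = psi_op a (fun r => Q q * R r + (Q (q%:Z - 1) * S r
    + (- Q (q%:Z - 2) * S (r - 2) + - Q (q%:Z - 3) * R (r - 1)))) r.
  rewrite /psi_op -!chi_norm; congr (_ + a * _).
  by rewrite /conv; apply: eq_bigr => s _; rewrite -chi_norm.
rewrite !psi_opD !psi_opZ; ring.
Qed.

End ConvExtra.

(** The coefficients in [psi_norm] and in [row_seqE] agree.  The coefficients of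
    Q_(q-2) and Q_(q-3) are those of Q_(q-1) and Q_q at r - 2 and r - 1; for the
    negative values of these indices, W is evaluated by reflection. *)
Lemma psi_wedge (F : comNzRingType) (a : F) (W : int -> int -> F) :
  (forall i, W i i = 0) -> (forall i j, W j i = - W i j) ->
  (forall i j, W i j = - a * W i (j - 2) - a * W i (j - 3) - W i (j - 5)) ->
  (forall i j, W i (- 1 - j) = W i j) ->
  W 0 1 = 1 -> W 0 2 = 0 -> W 1 2 = a ->
  forall q r : nat, psi a 1 q r = (-1) ^+ q * W r (r + q + 1)%N.
Proof.
move=> Wii WC Wrec Wrefl W01 W02 W12 q r.
have -> : (-1) ^+ q * W r (r + q + 1)%N = row_seq W r q by [].
rewrite (row_seqE Wii WC Wrec) psi_norm /row_pol !zactE.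
have Y0 := psi_op_R Wii WC Wrec Wrefl W01 W02 W12.
have Y1 := psi_op_sigmaR Wii WC Wrec Wrefl W01 W02 W12.
rewrite -(zeta_seq_nat F) Y1 !Y0.
have -> : diag2 W r = - W r (r%:Z + 2) by [].
have -> : diag1 W r = W r (r%:Z + 1) by [].
have -> : diag1 W (r%:Z - 1) = W (r%:Z - 1) r.
  case: r => [|r]; last first.
    have -> : r.+1%:Z - 1 = r by lia.
    by rewrite /diag1 /=; congr (W _ _); lia.
  by rewrite /diag1 /= (_ : 0 - 1 = - 1 - 0) // (Wrefll WC Wrefl) Wii.
have -> : (omega r)%:~R - psi_op a (sigmaR a) (r%:Z - 2) = W (r%:Z - 2) r.
  case: r => [|[|r]].
  - rewrite (psi_op_causal _ (@sigmaR_causal _ a)) // (_ : 0%:Z - 2 = - 1 - 1) //.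
    by rewrite (Wrefll WC Wrefl) (WC 0) W01 subr0.
  - rewrite (psi_op_causal _ (@sigmaR_causal _ a)) // (_ : 1%:Z - 2 = - 1 - 0) //.
    by rewrite (Wrefll WC Wrefl) W01 subr0.
  have -> : r.+2%:Z - 2 = r by lia.
  have := Y1 r; rewrite (zeta_seq_nat F) -addn2 omega_zeta /diag2 /= => e.
  rewrite PoszD.
  by rewrite -[RHS]opprK -e rmorphN /=; ring.
by ring.
Qed.

(** * Homogeneity of psi, and its value at a5 = 0 *)

Lemma int_ind_lt (P : int -> Prop) :
  (forall k, k < 0 -> P k) -> P 0 ->
  (forall k, 0 < k -> (forall j, j < k -> P j) -> P k) -> forall k, P k.
Proof.
move=> Pneg P0 Ppos k.
suff Pn n j : j < n%:Z -> P j by apply: (Pn `|k|.+1); lia.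
elim: n j => [|n IHn] j lt_j; first exact: Pneg.
have [j0|j0|->//] := ltrgtP j 0; first exact: Pneg.
by apply: Ppos => // i lt_i; apply: IHn; lia.
Qed.

Section Homogeneity.
Variables (A : comNzRingType) (F : fieldType) (h : {rmorphism A -> F}).
Variables (a1 a5 : A) (a : F).
Hypotheses (a5_neq0 : h a5 != 0) (ha1 : h a1 = h a5 * a).
Local Notation c := (h a5).

Let cE k (m : nat) : c ^ (k - m%:Z) = c ^ k / c ^+ m.
Proof. by rewrite expfzDr // -exprnN. Qed.

Lemma Qcoef_homog q : h (Qcoef a1 a5 q) = c ^ q * Qcoef a 1 q.
Proof.
elim/int_ind_lt: q => [q q0||q q0 IHq].
- by rewrite /Qcoef !rec_seq_lt0 // rmorph0 mulr0.
- by rewrite rmorph1 mulr1 expr0z.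
rewrite !Qcoef_rec // /Qstep !(rmorphD, rmorphN, rmorphM, rmorphXn) /=.
rewrite !IHq ?ha1; try lia.
by rewrite !cE !expr1n; field.
Qed.

Lemma Rcoef_homog r : h (Rcoef a1 a5 r) = c ^ r * Rcoef a 1 r.
Proof.
elim/int_ind_lt: r => [r r0||r r0 IHr].
- by rewrite /Rcoef !rec_seq_lt0 // rmorph0 mulr0.
- by rewrite rmorph1 mulr1 expr0z.
rewrite !Rcoef_rec // /Rstep.
rewrite rmorphD rmorph_sum /= [RHS]mulrDr big_distrr /=; congr (_ + _).
  rewrite !(rmorphD, rmorphN, rmorphM, rmorphXn) /= !IHr ?ha1; try lia.
  by rewrite !(cE r 4, cE r 5, cE r 1) !expr1n; field.
rewrite big_nat_cond [RHS]big_nat_cond; apply: eq_bigr => s.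
case/andP=> /andP[s3 _] _.
rewrite !(rmorphM, rmorphXn) /= rmorph_int IHr ?ha1; last lia.
rewrite cE expr1n (_ : c ^+ s = c ^+ (s - 2) * c ^+ 2).
  2: by rewrite -exprD subnK // ltnW.
field.
by rewrite a5_neq0 expf_neq0.
Qed.

Lemma chi_homog q r : h (chi a1 a5 q r) = c ^ (q + r) * chi a 1 q r.
Proof.
rewrite /chi !(rmorphD, rmorphN) rmorph_sum /= mulrDr mulrDr big_distrr /=.
rewrite mulrN; congr (_ + _ - _).
- by rewrite rmorphM Qcoef_homog Rcoef_homog expfzDr //; ring.
- apply: eq_bigr => s _.
  rewrite !(rmorphD, rmorphM, rmorphXn) /= !rmorph_int ?ha1 !Qcoef_homog !Rcoef_homog.
  rewrite !(cE q 1, cE q 2, cE r s) !expr1n expfzDr // (exprS c s) ?expr1; field.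
  by rewrite a5_neq0 expf_neq0.
rewrite !(rmorphM, rmorphXn) /= Qcoef_homog Rcoef_homog.
by rewrite !(cE q 3, cE r 1) expfzDr //; field.
Qed.

(** With a1 and a5 in degree 1, psi_(q,r) is homogeneous of degree q + r; this
    is combined with a ring morphism so as to move to a field in which a5 is
    invertible. *)
Lemma psi_homog q r : h (psi a1 a5 q r) = c ^+ (q + r)%N * psi a 1 q r.
Proof.
rewrite /psi; move: (chi a1 a5) (chi a 1) chi_homog => f g fg.
rewrite exprnP !(rmorphD h, rmorphN h) rmorph_sum !mulrDr big_distrr.
rewrite PoszD mulrN; congr (_ - _ + _ + _ + _).
- exact: fg.
- rewrite rmorphM rmorphXn fg addrA (cE (q%:Z + r) 3) expr1n; field.
  by [].
- rewrite /= big_nat_cond [RHS]big_nat_cond; apply: eq_bigr => -[//|s].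
  rewrite !(rmorphM, rmorphXn) /= rmorph_int ha1 fg addrA cE expr1n exprS => _.
  by field; rewrite a5_neq0 expf_neq0.
- rewrite !(rmorphM, rmorphXn) /= rmorph_int fg addr0 cE expr1n.
  by rewrite expfzDr // -!exprnP exprS; field.
rewrite !(rmorphM, rmorphXn) /= rmorph_int fg addr0 cE expr1n.
by rewrite expfzDr // -!exprnP !exprS; field.
Qed.

End Homogeneity.

(** At a5 = 0 one has Q_q = 0 for q > 0 and R_r = a1^r. *)
Lemma psi_a5_0 (A : comNzRingType) (a1 : A) (q r : nat) :
  psi a1 0 q r = (q == 0)%:R * a1 ^+ r.
Proof.
have Q0 (k : int) : Qcoef a1 0 k = (k == 0)%:R.
  have [k0|k0|->//] := ltrgtP k 0; first by rewrite /Qcoef rec_seq_lt0 // lt_eqF.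
  by rewrite Qcoef_rec // /Qstep !expr0n /=; ring.
have R0 (n : nat) : Rcoef a1 0 n = a1 ^+ n.
  elim: n => [//|n IHn]; rewrite Rcoef_rec // /Rstep.
  rewrite (_ : n.+1%:Z - 1 = n); last lia.
  rewrite big_nat_cond big1; first by rewrite IHn !expr0n exprS /=; ring.
  move=> s /andP[/andP[s3 _] _].
  by rewrite expr0n (_ : (s - 2 == 0)%N = false) ?mulr0 ?mul0r //; lia.
have chi0 (k m : int) : chi a1 0 k m = (k == 0)%:R * Rcoef a1 0 m.
  rewrite /chi Q0 big_nat_cond big1; first by rewrite expr0n /=; ring.
  move=> s /andP[/andP[s3 _] _].
  by rewrite !expr0n eqn0Ngt s3 /=; ring.
rewrite /psi chi0 R0 big_nat_cond big1; last first.
  by move=> [//|[//|s]] _; rewrite expr0n /=; ring.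
by rewrite !expr0n /= eqz_nat; ring.
Qed.

(** * Two determinant lemmas *)

Section MonicDet.
Variable F : comNzRingType.

Lemma scalar_sum (f : {poly F} -> F) (fP : scalar f) m (c : 'I_m -> F)
    (p : 'I_m -> {poly F}) :
  f (\sum_i c i *: p i) = \sum_i c i * f (p i).
Proof.
elim: m c p => [|m IHm] c p.
  by rewrite !big_ord0; have := fP (-1) 0 0; rewrite scaler0 addr0 mulN1r addNr.
by rewrite !big_ord_recl fP IHm.
Qed.

(** Expressing a basis with one monic polynomial in each degree through the
    powers of X is a unitriangular change of basis. *)
Lemma det_monic m (L : 'I_m -> {poly F} -> F) (p : nat -> {poly F}) :
  (forall i, scalar (L i)) -> (forall j, p j \is monic /\ size (p j) = j.+1) ->
  \det (\matrix_(i, j) L i (p j)) = \det (\matrix_(i, j < m) L i 'X^j).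
Proof.
move=> L_lin p_monic.
pose C : 'M[F]_m := \matrix_(j, k) (p j)`_k.
have -> : (\matrix_(i, j) L i (p j)) = (\matrix_(i, j < m) L i 'X^j) *m C^T.
  apply/matrixP => i j; rewrite !mxE.
  have -> : p j = \sum_(k < m) (p j)`_k *: 'X^k.
    rewrite -[in LHS](coefK (p j)) poly_def (p_monic j).2.
    rewrite (big_ord_widen m (fun k => (p j)`_k *: 'X^k)) // big_mkcond /=.
    apply: eq_bigr => k _; case: ltnP => // le_jk.
    by rewrite nth_default ?scale0r ?(p_monic j).2.
  rewrite scalar_sum //; apply: eq_bigr => k _.
  by rewrite !mxE mulrC.
rewrite det_mulmx det_tr (@det_trig _ _ C); last first.
  apply/is_trig_mxP => i j lt_ij; rewrite /C !mxE. rewrite nth_default //.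
  by rewrite (p_monic i).2.
rewrite big1 ?mulr1 // => i _; rewrite /C !mxE.
have [/monicP + size_p] := p_monic i; by rewrite /lead_coef size_p.
Qed.

(** Laplace expansion along the first two rows: the pair of removed columns is r
    < l+1, and c + (r <= c) + (l <= c) enumerates increasingly the columns that
    are left. *)
Lemma det_two_rows n (x y : nat -> F) (Z : 'I_n -> nat -> F) :
  \det (\matrix_(i < 2 + n, j < 2 + n)
     match split i with inl i => if i == 0 then x j else y j | inr i => Z i j end)
  = \sum_(l < n.+1) \sum_(r < l.+1)
      (-1) ^+ (l - r) * (x r * y l.+1 - x l.+1 * y r)
      * \det (\matrix_(i < n, c < n) Z i (c + (r <= c) + (l <= c))%N).
Proof.
set M := \matrix_(i, j) _.
pose D r l := \det (\matrix_(i < n, c < n) Z i (c + (r <= c) + (l <= c))%N).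
have DE (j : 'I_n.+2) (k : 'I_n.+1) :
    \det (row' ord0 (col' k (row' ord0 (col' j M))))
    = if (j <= k)%N then D j k else D k j.-1.
  have -> : row' ord0 (col' k (row' ord0 (col' j M)))
      = \matrix_(i < n, c < n) Z i (bump j (bump k c)).
    apply/matrixP => i c; rewrite !mxE /=.
    case: splitP => i' /=; rewrite /bump /= => ii'.
      by have := ltn_ord i'; rewrite -ii'.
    by congr Z; apply/val_inj => /=; move: ii'; lia.
  rewrite /D; case: leqP => jk; congr (\det _); apply/matrixP => i c; rewrite !mxE;
    congr Z; rewrite /bump; lia.
have -> : \det M = \sum_(j < n.+2) \sum_(k < n.+1)
   (-1) ^+ (j + k) * x j * y (bump j k) * (if (j <= k)%N then D j k else D k j.-1).
  rewrite (expand_det_row _ ord0); apply: eq_bigr => j _.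
  rewrite /cofactor (expand_det_row _ ord0) !big_distrr; apply: eq_bigr => k _ /=.
  rewrite /cofactor DE !mxE.
  case: splitP => [i' /= i0|i' //]; case: splitP => [i1 /= i10|i'' //].
  rewrite (_ : i' == 0); last by apply/eqP/val_inj.
  rewrite (_ : i1 == 0 = false); last by apply/eqP => /(congr1 val) /=; rewrite -i10.
  by rewrite !add0n exprD; ring.
pose G j k := (-1) ^+ (j + k) * x j * y (bump j k)
  * (if (j <= k)%N then D j k else D k j.-1).
(* each pair of columns occurs in both orders: as (j, k+1) when j <= k, where
   the second index counts the remaining columns, and as (k, j) when k < j *)
transitivity (\sum_(0 <= k < n.+1) \sum_(0 <= j < k.+1) G j k
   + \sum_(0 <= l < n.+1) \sum_(0 <= k < l.+1) G l.+1 k).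
  transitivity (\sum_(0 <= j < n.+2) \sum_(0 <= k < n.+1) G j k).
    by rewrite big_mkord; apply: eq_bigr => j _; rewrite big_mkord.
  transitivity (\sum_(0 <= j < n.+2) (\sum_(0 <= k < n.+1 | (j <= k)%N) G j k
     + \sum_(0 <= k < n.+1 | (k < j)%N) G j k)).
    apply: eq_bigr => j _; rewrite (bigID (fun k => j <= k)%N) /=.
    by congr (_ + _); apply: eq_bigl => k; rewrite ltnNge.
  rewrite big_split /=; congr (_ + _).
    rewrite (exchange_big_dep_nat predT) //=.
    rewrite big_nat_cond [RHS]big_nat_cond; apply: eq_bigr => k /andP[/andP[_ lek] _].
    by rewrite [RHS](@big_nat_widen _ _ _ _ _ n.+2) //; lia.
  rewrite big_nat_recl //= [X in X + _]big1_seq ?add0r; last by case.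
  rewrite big_nat_cond [RHS]big_nat_cond; apply: eq_bigr => k /andP[/andP[_ lek] _].
  by rewrite [RHS](@big_nat_widen _ _ _ _ _ n.+1) //; lia.
rewrite -big_split /= big_mkord; apply: eq_bigr => l _.
rewrite -big_split /= big_mkord; apply: eq_bigr => r _.
have le_rl : (r <= l)%N by rewrite -ltnS.
rewrite /G /bump le_rl add1n ltnNge le_rl /= add0n addSn exprS.
rewrite -/(D r l) [(r + l)%N]addnC.
have -> : (-1) ^+ (l + r) = (-1) ^+ (l - r) :> F.
  by rewrite -signr_odd oddD -oddB // signr_odd.
by ring.
Qed.

End MonicDet.

(** * Chebyshev polynomials of the third kind *)

Section Chebyshev.
Variable F : fieldType.

(** V_e(x + 1/x) is the quotient of x^(e+1/2) + x^-(e+1/2) by x^(1/2) +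
    x^(-1/2). *)
Fixpoint chebV (m : nat) : {poly F} :=
  match m with
  | 0 => 1
  | 1 => 'X - 1
  | (m'.+1 as k).+1 => 'X * chebV k - chebV m'
  end.

(** Monic Chebyshev polynomials of the first kind, written through those of the
    third kind.  In degree 0 the value is 1 and not 2: it matches the entries of
    the Weyl denominator in the column of exponent 0. *)
Definition chebT (m : nat) : {poly F} :=
  if m is m'.+1 then chebV m + chebV m' else 1.

Lemma chebV_rec m : chebV m.+2 = 'X * chebV m.+1 - chebV m.
Proof. by []. Qed.

Lemma monic_size_addl (p q : {poly F}) : p \is monic -> (size q < size p)%N ->
  p + q \is monic /\ size (p + q) = size p.
Proof.
move=> /monicP p1 lt_qp; split; last exact: size_polyDl.
by apply/monicP; rewrite lead_coefDl.
Qed.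

Lemma chebV_monic m : chebV m \is monic /\ size (chebV m) = m.+1.
Proof.
suff [] : (chebV m \is monic /\ size (chebV m) = m.+1) /\
          (chebV m.+1 \is monic /\ size (chebV m.+1) = m.+2) by [].
elim: m => [|m [IH0 [IHm IHs]]]; last split=> //.
  split; first by rewrite /= monic1 size_poly1.
  by rewrite /= -polyC1 monicXsubC size_XsubC.
have s1 : size ('X * chebV m.+1) = m.+3.
  by rewrite mulrC size_mulX ?IHs // monic_neq0.
rewrite -s1 chebV_rec; apply: monic_size_addl.
  by rewrite monicMl ?monicX.
by rewrite size_polyN s1 IH0.2.
Qed.

Lemma chebT_monic m : chebT m \is monic /\ size (chebT m) = m.+1.
Proof.
case: m => [|m]; first by rewrite /= monic1 size_poly1.
have [h1 h2] := chebV_monic m.+1; rewrite -h2; apply: monic_size_addl => //.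
by rewrite h2 (chebV_monic m).2.
Qed.

Lemma two_step (P : nat -> Prop) :
  P 0 -> P 1 -> (forall m, P m -> P m.+1 -> P m.+2) -> forall m, P m.
Proof.
move=> P0 P1 IH m; suff [] : P m /\ P m.+1 by [].
by elim: m => [|m [Pm Pm1]]; split=> //; apply: IH.
Qed.

Variable y : F.
Hypothesis y0 : y != 0.
Local Notation t := (y ^+ 2 + y ^- 2).

Lemma chebV_eval m :
  (y + y^-1) * (chebV m).[t] = y ^+ (2 * m).+1 + y ^- (2 * m).+1.
Proof.
elim/two_step: m => [||m IH0 IH1].
- by rewrite hornerC mulr1 expr1.
- by rewrite (_ : (2 * 1).+1 = 3)%N //= !hornerE; field.
rewrite chebV_rec !hornerE mulrBr mulrCA IH1 IH0.
rewrite (_ : (2 * m.+2).+1 = 4 + (2 * m).+1)%N; last lia.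
rewrite (_ : (2 * m.+1).+1 = 2 + (2 * m).+1)%N; last lia.
by rewrite !exprD; field; rewrite expf_neq0 ?y0.
Qed.

Lemma chebT_eval m :
  (chebT m).[t] = if m == 0%N then 1 else y ^+ (2 * m) + y ^- (2 * m).
Proof.
case: m => [|m]; first by rewrite hornerC.
rewrite /chebT; elim/two_step: m => [||m IH0 IH1].
- by rewrite (_ : 2 * 1 = 2)%N //= -polyC1 !(hornerD, hornerN, hornerX, hornerC); field.
- by rewrite (_ : 2 * 2 = 4)%N //= -polyC1 !(hornerD, hornerN, hornerM, hornerX, hornerC); field.
have -> : chebV m.+3 + chebV m.+2
    = 'X * (chebV m.+2 + chebV m.+1) - (chebV m.+1 + chebV m).
  by rewrite !chebV_rec; ring.
rewrite hornerD hornerN hornerM hornerX IH1 IH0 /=.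
rewrite (_ : 2 * m.+3 = 4 + (2 * m.+1))%N; last lia.
rewrite (_ : 2 * m.+2 = 2 + (2 * m.+1))%N; last lia.
by rewrite !exprD; field; rewrite expf_neq0 ?y0.
Qed.

End Chebyshev.

(** * The determinantal expansion of the product *)

Section Quadratic.
Variables (F : fieldType) (a : F).
Local Notation V := (chebV F).

(** For a5 = 1 and a1 = a, the factor of the product for one variable is
    x^(1/2) + x^(-1/2) times this polynomial in x + 1/x. *)
Definition quad : {poly F} := V 2 + a%:P.

Definition rem_coef (m : nat) (p : {poly F}) : F := (p %% quad)`_m.

(** The extension by V_(-1-j) = V_j, for which the three-term recurrence holds
    at every integer. *)
Definition chebVz (k : int) : {poly F} := match k with Posz m | Negz m => V m end.

Definition wedge (i j : int) : F :=
  rem_coef 0 (chebVz i) * rem_coef 1 (chebVz j)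
  - rem_coef 0 (chebVz j) * rem_coef 1 (chebVz i).

Lemma size_quad : size quad = 3.
Proof.
have [h1 h2] := chebV_monic F 2.
by rewrite /quad size_polyDl h2 // size_polyC; case: eqP.
Qed.

Lemma quad_monic : quad \is monic.
Proof.
have [h1 h2] := chebV_monic F 2.
by apply: (monic_size_addl h1 _).1; rewrite h2 size_polyC; case: eqP.
Qed.

Lemma rem_coef_scalar m : scalar (rem_coef m).
Proof. by move=> c p q; rewrite /rem_coef modpD modpZl coefD coefZ. Qed.

Lemma rem_coefD m p q : rem_coef m (p + q) = rem_coef m p + rem_coef m q.
Proof. by rewrite -[p]scale1r rem_coef_scalar mul1r scale1r. Qed.

Lemma rem_coefZ m c p : rem_coef m (c *: p) = c * rem_coef m p.
Proof. by rewrite /rem_coef modpZl coefZ. Qed.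

Lemma rem_coef_quad m p : rem_coef m (quad * p) = 0.
Proof. by rewrite /rem_coef modp_mulr coef0. Qed.

Lemma rem_coef_small m (p : {poly F}) : (size p < 3)%N -> rem_coef m p = p`_m.
Proof. by move=> sp; rewrite /rem_coef modp_small ?size_quad. Qed.

Lemma chebVz_step (k : int) : chebVz (k + 1) = 'X * chebVz k - chebVz (k - 1).
Proof.
case: k => [[|m]|[|m]].
- by rewrite /= mulr1.
- have -> : Posz m.+1 - 1 = m by lia.
  by have -> : Posz m.+1 + 1 = m.+2 by lia.
- have -> : Negz 0 + 1 = 0 by lia.
  have -> : Negz 0 - 1 = Negz 1 by lia.
  by rewrite /=; ring.
have -> : Negz m.+1 + 1 = Negz m by lia.
have -> : Negz m.+1 - 1 = Negz m.+2 by lia.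
by rewrite /chebVz chebV_rec; ring.
Qed.

(** Multiplication of V by x + 1/x is a symmetric shift, so that the combination
    of order 5 is a multiple of [quad]. *)
Lemma chebVz_quad (k : int) :
  chebVz k + a *: chebVz (k - 2) + a *: chebVz (k - 3) + chebVz (k - 5)
  = quad * (chebVz (k - 2) + chebVz (k - 3)).
Proof.
have e0 := chebVz_step (k - 1); have e1 := chebVz_step (k - 2).
have e2 := chebVz_step (k - 3); have e3 := chebVz_step (k - 4).
move: e0 e1 e2 e3; rewrite subrK.
rewrite (_ : k - 1 - 1 = k - 2); last lia.
rewrite (_ : k - 2 + 1 = k - 1); last lia.
rewrite (_ : k - 2 - 1 = k - 3); last lia.
rewrite (_ : k - 3 + 1 = k - 2); last lia.
rewrite (_ : k - 3 - 1 = k - 4); last lia.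
rewrite (_ : k - 4 + 1 = k - 3); last lia.
rewrite (_ : k - 4 - 1 = k - 5); last lia.
move=> e0 e1 e2 e3.
have e4 : chebVz (k - 4) = 'X * chebVz (k - 3) - chebVz (k - 2) by rewrite e2; ring.
have e5 : chebVz (k - 5) = 'X * chebVz (k - 4) - chebVz (k - 3) by rewrite e3; ring.
rewrite e5 e4 e0 e1 -!mul_polyC /quad /=; by ring.
Qed.

(** The remainders of V_0, V_1, V_2 modulo g are 1, X - 1 and -a, which gives
    the initial values of the wedge. *)
Lemma psi_chebV (q r : nat) :
  psi a 1 q r = (-1) ^+ q * wedge r (r + q + 1)%N.
Proof.
have Z2 m : rem_coef m (chebVz 2) = - a * (m == 0%N)%:R.
  rewrite (_ : chebVz 2 = quad * 1 + (- a) *: 1).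
    by rewrite rem_coefD rem_coef_quad rem_coefZ add0r rem_coef_small ?size_poly1 // coef1.
  by rewrite /quad -mul_polyC /=; ring.
have r0 m : rem_coef m (chebVz 0) = (m == 0%N)%:R.
  by rewrite rem_coef_small ?size_poly1 // coef1.
have r1 m : rem_coef m (chebVz 1) = (m == 1%N)%:R - (m == 0%N)%:R.
  by rewrite rem_coef_small ?coefB ?coefX ?coef1 //= -polyC1 size_XsubC.
apply: psi_wedge => {q r}.
- by move=> i; rewrite /wedge subrr.
- by move=> i j; rewrite /wedge opprB.
- move=> i j; have e m : rem_coef m (chebVz j) = - a * rem_coef m (chebVz (j - 2))
      - a * rem_coef m (chebVz (j - 3)) - rem_coef m (chebVz (j - 5)).
    have := rem_coef_quad m (chebVz (j - 2) + chebVz (j - 3)).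
    rewrite -chebVz_quad !rem_coefD !rem_coefZ => e.
    by apply/eqP; rewrite -subr_eq0 -[X in _ == X]e; apply/eqP; ring.
  by rewrite /wedge !e; ring.
- move=> i j; rewrite /wedge; suff -> : chebVz (- 1 - j) = chebVz j by [].
  case: j => m; first by rewrite (_ : - 1 - Posz m = Negz m) //; lia.
  by rewrite (_ : - 1 - Negz m = Posz m) //; lia.
- by rewrite /wedge !r0 !r1 /=; ring.
- by rewrite /wedge !Z2 !r0 /=; ring.
by rewrite /wedge !Z2 !r1 /=; ring.
Qed.

Variables (n : nat) (t : 'I_n -> F).

Definition minorV r l :=
  \det (\matrix_(i < n, c < n) (V (c + (r <= c) + (l <= c))%N).[t i]).

(** In the basis 1, X, g, g X, g X^2, .. the determinant of the two remainder
    functionals and the n evaluations is block triangular, and equals the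
    left-hand side; in the basis of the V_e it is the right-hand side, by
    Laplace expansion. *)
Lemma prod_quad_minors :
  \prod_i (quad).[t i] * \det (\matrix_(i < n, c < n) t i ^+ c)
  = \sum_(l < n.+1) \sum_(r < l.+1) psi a 1 (l - r) r * minorV r l.
Proof.
pose L (i : 'I_(2 + n)) : {poly F} -> F :=
  match split i with inl i => if i == 0 then rem_coef 0 else rem_coef 1
                   | inr i => horner_eval (t i) end.
have L_lin i : scalar (L i).
  rewrite /L; case: split => [i'|i']; first by case: ifP => _; apply: rem_coef_scalar.
  by move=> c p q; rewrite /horner_eval !hornerE.
(* the monic basis adapted to division by quad *)
pose B m : {poly F} := if m is k.+2 then quad * 'X^k else 'X^m.
have B_monic m : B m \is monic /\ size (B m) = m.+1.
  case: m => [|[|m]] /=; rewrite ?monicXn ?size_polyXn //.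
  rewrite monicMl ?monicXn ?quad_monic // size_mulXn ?monic_neq0 ?quad_monic //.
  by rewrite size_quad addnC.
have sl i : split (lshift n i : 'I_(2 + n)) = inl i := unsplitK (inl i).
have sr i : split (rshift 2 i : 'I_(2 + n)) = inr i := unsplitK (inr i).
have := det_monic L_lin B_monic; rewrite -(det_monic L_lin (chebV_monic F)).
have -> : (\matrix_(i, j < 2 + n) L i (B j)) = block_mx 1%:M 0
    (\matrix_(i, j) L (rshift 2 i) (B j))
    (diag_mx (\row_i (quad).[t i]) *m (\matrix_(i < n, c < n) t i ^+ c)).
  apply/matrixP => i j; rewrite mxE.
  case: (split_ordP i) => i' ->; case: (split_ordP j) => j' ->.
  - rewrite block_mxEul mxE /L sl.
    by case: i' j' => [[|[|//]] ?] [[|[|//]] ?];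
      rewrite /= rem_coef_small ?size_polyXn // coefXn.
  - rewrite block_mxEur mxE /L sl /=.
    by case: ifP => _; rewrite rem_coef_quad.
  - by rewrite block_mxEdl mxE.
  by rewrite block_mxEdr mul_diag_mx !mxE /L sr /= /horner_eval !hornerE.
rewrite det_lblock det1 mul1r det_mulmx det_diag.
under eq_bigr do rewrite mxE.
move=> ->.
have := det_two_rows (fun j => rem_coef 0 (V j)) (fun j => rem_coef 1 (V j))
  (fun i j => (V j).[t i]).
set M := (X in \det X = _ -> _); have -> : \matrix_(i, j) L i (V j) = M.
  apply/matrixP => i j; rewrite !mxE /L.
  by case: split => // i'; case: ifP.
move=> ->; apply: eq_bigr => l _; apply: eq_bigr => r _.
rewrite psi_chebV (_ : r + (l - r) + 1 = l.+1)%N //.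
by have := ltn_ord r; lia.
Qed.

End Quadratic.

(** * Weyl sums of type D as determinants *)

Section EvenSubsets.
Variables (F : comNzRingType) (I : finType) (i0 : I).
Implicit Types (z : I -> bool -> F) (S T : {set I}).

(** An even set is determined by its intersection with the complement of i0,
    whose parity decides whether i0 belongs to it. *)
Lemma sum_even_sets z :
  \sum_(S : {set I} | ~~ odd #|S|) \prod_i z i (i \in S)
  = \sum_(T : {set I} | i0 \notin T)
      (\prod_(i | i != i0) z i (i \in T)) * z i0 (odd #|T|).
Proof.
(* h completes a set avoiding i0 to an even set *)
pose h T := if odd #|T| then i0 |: T else T.
rewrite (reindex_onto h (fun S => S :\ i0)) /=; last first.
  move=> S; rewrite /h (cardsD1 i0 S) oddD oddb.
  case: (boolP (i0 \in S)) => Si0 /=; first by rewrite negbK => ->; rewrite setD1K.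
  move=> /negbTE ->; apply/setDidPl.
  by rewrite disjoint_sym disjoints1.
apply: eq_big => [T|T].
  rewrite /h; case: (boolP (i0 \in T)) => Ti0.
    rewrite [X in _ && X](_ : _ = false) ?andbF //; apply/negbTE/eqP => e.
    by move: Ti0; rewrite -e !inE eqxx.
  have -> : (if odd #|T| then i0 |: T else T) :\ i0 = T.
    case: ifP => _; first by rewrite setU1K.
    by apply/setDidPl; rewrite disjoint_sym disjoints1.
  by rewrite eqxx andbT; case: ifP => oT; rewrite ?cardsU1 ?Ti0 /= ?oT.
rewrite /h => /andP[_ /eqP e]; have Ti0 : i0 \notin T by rewrite -e !inE eqxx.
rewrite (bigD1 i0) //= mulrC; congr (_ * z i0 _).
  by apply: eq_bigr => i ii0; congr (z i _); case: ifP; rewrite ?inE ?(negbTE ii0).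
by case: ifP; rewrite ?inE ?eqxx //= (negbTE Ti0).
Qed.

Lemma prod_pair_sets z :
  \sum_(T : {set I} | i0 \notin T) \prod_(i | i != i0) z i (i \in T)
  = \prod_(i | i != i0) (z i true + z i false).
Proof.
(* these values at i0 kill the sets containing i0 *)
pose z' i b := if i == i0 then (~~ b)%:R else z i b.
transitivity (\prod_i (z' i true + z' i false)); last first.
  rewrite (bigD1 i0) //= /z' eqxx add0r mul1r; apply: eq_bigr => i.
  by move=> /negbTE ->.
rewrite (bigA_distr _ _ (fun i => z' i true)).
rewrite [RHS](bigID (fun T : {set I} => i0 \notin T)).
rewrite /= [X in _ + X]big1 ?addr0; last first.
  by move=> T /negbNE Ti0; rewrite (bigD1 i0) //= Ti0 /z' eqxx mul0r.
apply: eq_bigr => T Ti0; rewrite [RHS](bigD1 i0) //= (negbTE Ti0) /z' eqxx mul1r.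
by apply: eq_bigr => i /negbTE ->; case: ifP.
Qed.

(** When the factor at i0 is trivial, nothing remembers the parity: the sum
    factors over the other indices.  Halving the sum over all sets would require
    2 to be invertible. *)
Lemma sum_even_sets1 z : (forall b, z i0 b = 1) ->
  \sum_(S : {set I} | ~~ odd #|S|) \prod_i z i (i \in S)
  = \prod_(i | i != i0) (z i true + z i false).
Proof.
move=> z1; rewrite sum_even_sets -prod_pair_sets.
by apply: eq_bigr => T _; rewrite z1 mulr1.
Qed.

(** Flipping the choice at i0 exchanges even and odd sets, so the two sums
    together run over all sets. *)
Lemma sum_even_sets_flip z w :
  (forall i b, w i b = z i (b (+) (i == i0))) ->
  \sum_(S : {set I} | ~~ odd #|S|) \prod_i z i (i \in S)
  + \sum_(S : {set I} | ~~ odd #|S|) \prod_i w i (i \in S)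
  = \prod_i (z i true + z i false).
Proof.
move=> wz; rewrite !sum_even_sets -big_split /= (bigD1 i0) //=.
rewrite -prod_pair_sets big_distrr; apply: eq_bigr => T _ /=.
rewrite wz eqxx addbT.
rewrite [X in _ + X * _](_ : _ = \prod_(i | i != i0) z i (i \in T)); last first.
  by apply: eq_bigr => i /negbTE ii0; rewrite wz ii0 addbF.
by rewrite -mulrDr mulrC; case: odd; rewrite //= [z i0 _ + _]addrC.
Qed.

End EvenSubsets.

Section WeylSums.
Variables (A : idomainType) (n : nat).
Local Notation F := (ratfun A n).
Local Notation y := (sqrtx A).
Implicit Types (mu lam : 'cV[int]_n).

Lemma sqrtx_neq0 (i : 'I_n) : y i != 0.
Proof.
rewrite tofrac_eq0; apply/eqP => /(congr1 (fun p : {mpoly A[n]} => p@_U_(i))).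
by rewrite mcoeffXU eqxx mcoeff0 => /eqP; rewrite oner_eq0.
Qed.

Lemma weyl_altE mu : weyl_alt A mu = \sum_(s : 'S_n) (-1) ^+ s *
  \sum_(S : {set 'I_n} | ~~ odd #|S|)
     \prod_i y i ^ ((-1) ^+ (i \in S) * mu (s i) ord0).
Proof.
apply: eq_bigr => s _; rewrite big_distrr; apply: eq_bigr => S evS /=.
congr (_ * _).
  rewrite /signed_perm det_mulmx det_diag det_perm.
  under eq_bigr do rewrite mxE.
  have -> : \prod_(i < n) (-1) ^+ (i \in S) = 1 :> int.
    rewrite prodrXr -signr_odd (_ : \sum_i _ = #|S|)%N ?(negbTE evS) //.
    by rewrite -sum1_card [RHS]big_mkcond; apply: eq_bigr => i _; case: (i \in S).
  by rewrite mul1r rmorph_sign.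
rewrite /xpow /signed_perm -mulmxA; apply: eq_bigr => i _; congr (_ ^ _).
by rewrite mul_diag_mx -row_permE !mxE.
Qed.

Variable last : 'I_n.
Hypothesis lastP : last.+1 = n.

(** This makes the last column of the Weyl denominator constant, and lets the last
    sign of a weight be flipped before or after adding the Weyl vector. *)
Lemma rho_last : weyl_rho n last ord0 = 0.
Proof. by rewrite mxE lastP subnn. Qed.

Lemma weyl_alt_rho : weyl_alt A (weyl_rho n) = \det (\matrix_(i, j)
  if j == last then 1 else y i ^ (weyl_rho n j ord0) + y i ^ (- weyl_rho n j ord0)).
Proof.
rewrite weyl_altE; apply: eq_bigr => s _; congr (_ * _).
pose i0 := (s^-1)%g last.
have i0E i : (i == i0) = (s i == last) by rewrite /i0 -(inj_eq (@perm_inj _ s)) permKV.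
rewrite (@sum_even_sets1 _ _ i0 (fun i b => y i ^ ((-1) ^+ b * weyl_rho n (s i) ord0))).
  rewrite [RHS](bigD1 i0) //= mxE -i0E eqxx mul1r; apply: eq_bigr => i ii0.
  by rewrite mxE -i0E (negbTE ii0) expr1 expr0 mul1r mulN1r addrC.
by move=> b; rewrite /i0 permKV rho_last mulr0.
Qed.

Lemma weyl_alt_flip lam : weyl_alt A (lam + weyl_rho n)
    + weyl_alt A (flip_last lam + weyl_rho n)
  = \det (\matrix_(i, j) (y i ^ ((lam + weyl_rho n) j ord0)
                          + y i ^ (- (lam + weyl_rho n) j ord0))).
Proof.
rewrite !weyl_altE -big_split; apply: eq_bigr => s _ /=; rewrite -mulrDr.
congr (_ * _); pose i0 := (s^-1)%g last.
have i0E i : (i == i0) = (s i == last) by rewrite /i0 -(inj_eq (@perm_inj _ s)) permKV.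
rewrite (@sum_even_sets_flip _ _ i0
  (fun i b => y i ^ ((-1) ^+ b * (lam + weyl_rho n) (s i) ord0))
  (fun i b => y i ^ ((-1) ^+ b * (flip_last lam + weyl_rho n) (s i) ord0))).
  by apply: eq_bigr => i _; rewrite mxE expr1 expr0 mul1r mulN1r addrC.
have addE mu j : (mu + weyl_rho n) j ord0 = mu j ord0 + weyl_rho n j ord0 by rewrite mxE.
have flipE j : flip_last lam j ord0 = if j == last then - lam j ord0 else lam j ord0.
  by rewrite mxE -{2}lastP eqSS.
move=> i b; congr (_ ^ _); rewrite i0E !addE flipE.
case: eqP => [->|_]; last by rewrite addbF.
by rewrite rho_last !addr0; case: b; rewrite /= ?expr1 ?expr0; ring.
Qed.

End WeylSums.

(** * Spin characters as quotients of minors *)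

(** The difference of the two sides of the equation is, up to a unit, the product
    of y^2 - z^2 and y^2 z^2 - 1. *)
Lemma trace_eq_dichotomy (F : fieldType) (y z : F) : y != 0 -> z != 0 ->
  y ^+ 2 + y ^- 2 = z ^+ 2 + z ^- 2 -> (y ^+ 2 == z ^+ 2) || (y ^+ 2 * z ^+ 2 == 1).
Proof.
move=> y0 z0 /eqP; rewrite -subr_eq0 => /eqP e.
rewrite -subr_eq0 -[X in _ || X]subr_eq0 -mulf_eq0.
have -> : (y ^+ 2 - z ^+ 2) * (y ^+ 2 * z ^+ 2 - 1)
  = y ^+ 2 * z ^+ 2 * (y ^+ 2 + y ^- 2 - (z ^+ 2 + z ^- 2)).
  by field; rewrite z0 y0.
by rewrite e mulr0.
Qed.

Section SpinCharacters.
Variables (A : idomainType) (n : nat).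
Local Notation F := (ratfun A n).
Local Notation y := (sqrtx A).

(** x_i + 1/x_i, in terms of the square root of x_i. *)
Definition trace_var (i : 'I_n) : F := y i ^+ 2 + y i ^- 2.

Lemma mpolyX_inj m1 m2 : 'X_[m1] = 'X_[m2] :> {mpoly A[n]} -> m1 = m2.
Proof.
move/(congr1 (fun p : {mpoly A[n]} => p@_m2)); rewrite !mcoeffX eqxx.
by case: eqP => // _ /eqP; rewrite eq_sym oner_eq0.
Qed.

Lemma trace_var_inj : injective trace_var.
Proof.
have yE k : y k ^+ 2 = tofrac 'X_[U_(k) *+ 2].
  by rewrite -mpolyXn tofracXn.
move=> i j /(trace_eq_dichotomy (sqrtx_neq0 A i) (sqrtx_neq0 A j)).
rewrite !yE => /orP[]; last first.
  rewrite -tofracM -tofrac1 tofrac_eq -mpolyXD -mpolyX0.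
  move=> /eqP/mpolyX_inj/mnmP/(_ i).
  by rewrite mnmDE !mulmnE mnm0E mnm1E eqxx.
rewrite tofrac_eq => /eqP/mpolyX_inj/mnmP/(_ i).
by rewrite !mulmnE !mnm1E eqxx; case: eqP.
Qed.

Local Notation vdm := (\det (\matrix_(i < n, c < n) trace_var i ^+ c)).

Lemma vdm_neq0 : vdm != 0.
Proof.
have -> : (\matrix_(i < n, c < n) trace_var i ^+ c)
    = (Vandermonde n (\row_i trace_var i))^T.
  by apply/matrixP => i c; rewrite !mxE.
rewrite det_tr det_Vandermonde; apply/prodf_neq0 => i _; apply/prodf_neq0 => j ij.
by rewrite !mxE subr_eq0 (inj_eq trace_var_inj) gt_eqF.
Qed.

Lemma det_horner_monic (p : nat -> {poly F}) :
  (forall j, p j \is monic /\ size (p j) = j.+1) ->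
  \det (\matrix_(i < n, c < n) (p c).[trace_var i]) = vdm.
Proof.
move=> p_monic.
have L_lin (i : 'I_n) : scalar (horner_eval (trace_var i)).
  by move=> c u v; rewrite /horner_eval !hornerE.
rewrite -[LHS]/(\det (\matrix_(i, c) horner_eval (trace_var i) (p c))).
rewrite (det_monic L_lin p_monic); congr (\det _); apply/matrixP => i c.
by rewrite !mxE /horner_eval hornerXn.
Qed.

(** The columns of the Weyl determinants come in decreasing order of exponents;
    the sign of the reversal will cancel in the quotient. *)
Lemma det_rev (M : 'M[F]_n) : \det (\matrix_(i, j) M i (rev_ord j))
  = \det (perm_mx (perm (@rev_ord_inj n))) * \det M.
Proof.
have -> : (\matrix_(i, j) M i (rev_ord j)) = col_perm (perm (@rev_ord_inj n)) M.
  by apply/matrixP => i j; rewrite !mxE permE.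
by rewrite col_permE det_mulmx !det_perm odd_permV mulrC.
Qed.

Lemma chO_weight531 p q : (p + q <= n)%N -> (0 < n)%N ->
  chO A (weight531 n p q)
  = \prod_(i < n) (y i + (y i)^-1) * (minorV trace_var (n - p - q) (n - p) / vdm).
Proof.
move=> le_pq n_gt0.
have last_lt : (n.-1 < n)%N by rewrite prednK.
have lastP : (Ordinal last_lt).+1 = n by rewrite /= prednK.
rewrite /chO /chSO -mulrDl (weyl_alt_flip _ lastP) (weyl_alt_rho _ lastP).
pose B (i c : 'I_n) : F :=
  (chebV F (c + (n - p - q <= c) + (n - p <= c))%N).[trace_var i].
set N := \matrix_(i, j) (_ + _); set D := (\matrix_(i, j) (if _ then _ else _)).
have -> : D = \matrix_(i, j) (\matrix_(i, c < n) (chebT F c).[trace_var i]) i (rev_ord j).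
  apply/matrixP => i j; rewrite !mxE chebT_eval ?sqrtx_neq0 //=.
  have -> : (j == Ordinal last_lt) = (n - j.+1 == 0)%N.
    by rewrite -val_eqE /=; have := ltn_ord j; lia.
  by case: ifP => // _; rewrite -exprnP exprnN.
have -> : N = \matrix_(i, j)
    (diag_mx (\row_i (y i + (y i)^-1)) *m \matrix_(i, c) B i c) i (rev_ord j).
  apply/matrixP => i j; rewrite [RHS]mxE mul_diag_mx !mxE chebV_eval ?sqrtx_neq0 //=.
  set m := (if _ then _ else _) + _; set e := (2 * _).+1.
  have -> : m = e%:Z; last by rewrite -exprnP exprnN.
  rewrite /m /e; have jn := ltn_ord j.
  by case: (ltnP j p) => jp; last case: (ltnP j (p + q)) => jpq; lia.
rewrite !det_rev (det_horner_monic (chebT_monic F)) det_mulmx det_diag.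
under eq_bigr do rewrite mxE.
rewrite -mulf_div divff ?mul1r ?mulrA //.
by rewrite det_perm signr_eq0.
Qed.

End SpinCharacters.

Theorem theoremA2 (A : idomainType) (n : nat) (a1 a5 : A) (n_gt0 : (0 < n)%N) :
  \prod_(i < n)
     (cst n a1 * (sqrtx A i + (sqrtx A i)^-1)
      + cst n a5 * (sqrtx A i ^+ 5 + sqrtx A i ^- 5))
  = \sum_(p < n.+1) \sum_(q < (n - p).+1)
      cst n a5 ^+ p * cst n (psi a1 a5 q (n - p - q)%N)
      * chO A (weight531 n p q).
Proof.
pose y := sqrtx A (n := n); pose t := @trace_var A n.
pose h : {rmorphism A -> ratfun A n} := (@tofrac {mpoly A[n]}) \o (@mpolyC n A).
pose vdm := \det (\matrix_(i < n, c < n) t i ^+ c).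
pose b := \prod_(i < n) (y i + (y i)^-1).
have y5 i : y i ^+ 5 + y i ^- 5 = (y i + (y i)^-1) * (chebV _ 2).[t i].
  by rewrite chebV_eval // sqrtx_neq0.
have -> : \prod_(i < n) (cst n a1 * (y i + (y i)^-1) + cst n a5 * (y i ^+ 5 + y i ^- 5))
  = b * \prod_(i < n) (h a1 + h a5 * (chebV _ 2).[t i]).
  rewrite -big_split; apply: eq_bigr => i _; rewrite y5 /=; ring.
transitivity (\sum_(p < n.+1) \sum_(q < (n - p).+1)
   h a5 ^+ p * h (psi a1 a5 q (n - p - q)%N) * (b * (minorV t (n - p - q) (n - p) / vdm)));
  last first.
  apply: eq_bigr => p _; apply: eq_bigr => q _; congr (_ * _).
  rewrite chO_weight531 //; have := ltn_ord p; have := ltn_ord q; lia.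
have h_inj0 : h a5 = 0 -> a5 = 0.
  by move/eqP; rewrite /h /= tofrac_eq0 mpolyC_eq0 => /eqP.
(* an opaque embedding h keeps simplification from computing with fractions *)
clearbody h; have [a50|a50] := eqVneq (h a5) 0.
  rewrite (h_inj0 a50) {h_inj0 a50}.
  (* only p = q = 0 contributes *)
  rewrite big_ord_recl [X in _ + X]big1 ?addr0; last first.
    by move=> p _; apply: big1 => q _; rewrite rmorph0 expr0n /= !mul0r.
  rewrite big_ord_recl [X in _ + X]big1 ?addr0; last first.
    by move=> q _; rewrite psi_a5_0 mul0r rmorph0 mulr0 mul0r.
  rewrite psi_a5_0 !subn0 expr0 !mul1r rmorph0 rmorphXn.
  have -> : minorV t n n = vdm.
    have <- : _ = vdm := @det_horner_monic A n _ (chebV_monic _); congr (\det _).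
    by apply/matrixP => i c; rewrite !mxE leqNgt ltn_ord !addn0.
  rewrite divff ?vdm_neq0 // mulr1 mulrC; congr (_ * _).
  by under eq_bigr do rewrite mul0r addr0; rewrite prodr_const card_ord.
pose a := h a1 / h a5.
have ha1 : h a1 = h a5 * a by rewrite /a mulrCA divff // mulr1.
have -> : \prod_(i < n) (h a1 + h a5 * (chebV _ 2).[t i])
    = h a5 ^+ n * \prod_(i < n) (quad a).[t i].
  rewrite -[in X in _ ^+ X](card_ord n) -prodr_const -big_split.
  by apply: eq_bigr => i _; rewrite ha1 /quad hornerD hornerC /=; ring.
have -> : \prod_(i < n) (quad a).[t i]
   = (\prod_(i < n) (quad a).[t i] * vdm) / vdm by rewrite mulfK ?vdm_neq0.
rewrite (prod_quad_minors a t) (reindex_inj rev_ord_inj) /=.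
rewrite mulrA big_distrl big_distrr; apply: eq_bigr => p _ /=; rewrite subSS.
rewrite (reindex_inj rev_ord_inj) /= big_distrl big_distrr; apply: eq_bigr => q _ /=.
rewrite subSS (psi_homog a50 ha1).
have le_p : (p <= n)%N by rewrite -ltnS.
have le_q : (q <= n - p)%N by rewrite -ltnS.
rewrite subKn //; have -> : h a5 ^+ n = h a5 ^+ p * h a5 ^+ (q + (n - p - q))%N.
  by rewrite -exprD; congr (_ ^+ _); lia.
ring.
Qed.
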